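(* Let $p,q$ be mutually prime integers with $1<q<p$, and let $Z_k(L(p,q))$ be the level $k$ Witten–Reshetikhin–Turaev invariant of the lens space $L(p,q)$. Then there exist an integer $m$ and sequences of complex numbers $(a_{\ell,n})_{n\ge0}$, $\ell=0,1,\dots,p-1$, such that for any $N$, $$Z_k(L(p,q))=e^{im\pi/4}\sum_{\ell=0}^{p-1}k^{m(\ell)}e^{2i\pi\frac{q\ell^2}pk}\sum_{n=0}^Na_{\ell,n}k^{-n}+O(k^{-N-1})\qquad(k\to\infty),$$ where, if $\ell=0$ or $\ell=p/2$, $$m(\ell)=-\tfrac32,\qquad a_{\ell,0}=-i\,\frac{\sqrt2\,\pi}{p^{3/2}},$$ and otherwise $$m(\ell)=-\tfrac12,\qquad a_{\ell,0}=\sqrt{\tfrac2p}\,\sin\Bigl(\frac{2\pi q\ell}p\Bigr)\sin\Bigl(\frac{2\pi\ell}p\Bigr).$$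
   Context: **Lens space.** Let $\varphi$ be an orientation-preserving homeomorphism of $\mathbb T^2=S^1\times S^1$ sending $\{1\}\times S^1$ onto $\{(z^p,z^q):z\in S^1\}$. Let $N_1,N_2$ be two copies of the solid torus bounded by $\mathbb T^2$ in which $\{1\}\times S^1$ bounds a disc (i.e. $S^1\times D^2$), oriented so that the boundary is $\mathbb T^2$ with its standard orientation. Then $L(p,q)=N_1\cup_{x_1\sim\varphi(x_2)}(-N_2)$. **Invariant.** $Z_k$ is the $\mathrm{SU}_2$ TQFT invariant of Blanchet–Habegger–Masbaum–Vogel at level $k$ (built from the Kauffman bracket at $A=-e^{i\pi/2k}$), normalized by $Z_k(S^3)=\sqrt{2/k}\,\sin(\pi/k)$. It may be computed as $\langle Z_k(N_1),Z_k(N_2)\rangle$ in the Hermitian space $V_k(\mathbb T^2)$, the boundaries of $N_1$ and $N_2$ being identified with $\mathbb T^2$ by $\mathrm{id}$ and $\varphi$. The anomaly is disregarded: $Z_k$ is considered up to multiplication by $\tau_k^n$, with $n$ an integer independent of $k$ and $\tau_k=e^{\frac{3i\pi}4-\frac{3i\pi}{2k}}$. *)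

(* Defs.v *)
From mathcomp Require Export all_boot all_order all_algebra.
From mathcomp Require Export all_classical all_reals all_analysis.
From mathcomp.real_closed Require Export complex.

Set Implicit Arguments.
Unset Strict Implicit.
Unset Printing Implicit Defensive.

Export Order.TTheory GRing.Theory Num.Theory.
Export numFieldNormedType.Exports.

Local Open Scope ring_scope.
Local Open Scope complex_scope.

(* The SU(2) TQFT of Blanchet-Habegger-Masbaum-Vogel in genus one.

   V_k(T^2) is the Kauffman skein module of the solid torus S^1 x D^2 at
   A = - e^(i pi / 2k), modulo the radical of the bilinear form obtained by
   gluing two solid tori into S^3.  It has an orthonormal basis
   e_0, ..., e_(k-2), where e_c is the core coloured by the c-th Chebyshev
   polynomial; e_0 is the empty skein, that is, Z_k(S^1 x D^2).  Vectors of
   V_k(T^2) are the columns of coordinates in that basis, so the colour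
   c : 'I_(k.-1) is the (c+1)-dimensional representation of SU(2). *)

Section TorusTQFT.
Context (R : realType).
Implicit Types (k c d : nat) (t : R).

Definition expi t : R[i] := cos t +i* sin t.

Definition kauffman_A k : R[i] := - expi (pi / (2 * k%:R)).

Definition quantum_int k n : R[i] :=
  let A := kauffman_A k in (A ^+ (2 * n) - A ^- (2 * n)) / (A ^+ 2 - A ^- 2).

(* The scalar by which a full positive twist acts on a c-coloured strand. *)
Definition twist k c : R[i] := (-1) ^+ c * kauffman_A k ^+ (c ^ 2 + 2 * c).

(* The Kauffman bracket of the zero-framed Hopf link coloured by c and d. *)
Definition hopf k c d : R[i] :=
  (-1) ^+ (c + d) * quantum_int k (c.+1 * d.+1).

Definition Z_S3 k : R[i] := (Num.sqrt (2 / k%:R) * sin (pi / k%:R))%:C.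

Definition torus_space k : Type := 'cV[R[i]]_k.-1.

Definition Z_solid_torus k : torus_space k :=
  \col_(c < k.-1) (val c == 0%N)%:R.

(* Linear in the first variable, as in Z(M1 u -M2) = <Z(M1), Z(M2)>. *)
Definition hermitian k (u v : torus_space k) : R[i] :=
  \sum_(c < k.-1) u c 0 * (v c 0)^*%C.

Definition S_op k : 'M[R[i]]_k.-1 := \matrix_(c, d) (Z_S3 k * hopf k c d).

Definition T_op k : 'M[R[i]]_k.-1 := diag_mx (\row_c (twist k c)^-1).

(* Orientation-preserving homeomorphisms of T^2 = S^1 x S^1, up to isotopy,
   are given by their action on H_1(T^2), written on columns in the basis
   (1, 0) = [S^1 x {1}], (0, 1) = [{1} x S^1].  The solid torus is the one in
   which (0, 1) bounds a disc.

   S_mat is (x, y) |-> (- y, x); gluing two solid tori along it gives S^3.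
   T_mat is the Dehn twist (x, y) |-> (x, x + y), which extends to the solid
   torus.  For the orientation of the solid torus whose boundary is T^2 with
   the orientation in which (1, 0) . (0, 1) = +1, the extension adds a framing
   -1 to the core: with the outward normal first, the meridian of positive
   linking number with the core is - (0, 1).  This is why T_op has the inverse
   twist coefficients. *)
Definition S_mat : 'M[int]_2 := delta_mx 1 0 - delta_mx 0 1.
Definition T_mat : 'M[int]_2 := 1%:M + delta_mx 1 0.

(* mcg_action phi U: the family U = (U_k)_k is an action of phi on the spaces
   V_k(T^2) for all k simultaneously, obtained from one way of writing phi as a
   word in the generators.  Different words give families that differ by the
   anomaly (tau_k ^ n)_k. *)
Inductive mcg_action :
    'M[int]_2 -> (forall k : nat, 'M[R[i]]_k.-1) -> Prop :=
| mcg_S : mcg_action S_mat S_op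
| mcg_T : mcg_action T_mat T_op
| mcg_one : mcg_action 1%:M (fun k => 1%:M)
| mcg_inv phi U : mcg_action phi U ->
    mcg_action (invmx phi) (fun k => invmx (U k))
| mcg_mul phi psi U V : mcg_action phi U -> mcg_action psi V ->
    mcg_action (phi *m psi) (fun k => U k *m V k).

Definition tau k : R[i] := expi (3 * pi / 4 - 3 * pi / (2 * k%:R)).

(* phi preserves the orientation and sends the curve {1} x S^1 onto
   {(z^p, z^q)}; the sign is there because it may reverse the direction. *)
Definition lens_gluing (p q : nat) (phi : 'M[int]_2) : Prop :=
  \det phi = 1 /\
  exists s : bool, phi 0 1 = (-1) ^+ s * p%:Z /\ phi 1 1 = (-1) ^+ s * q%:Z.

(* Z = (Z_k)_k is a representative of the invariant of L(p, q), which is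
   defined up to the anomaly. *)
Definition is_Z_lens (p q : nat) (Z : nat -> R[i]) : Prop :=
  exists (phi : 'M[int]_2) (U : forall k : nat, 'M[R[i]]_k.-1) (n : int),
    [/\ lens_gluing p q phi, mcg_action phi U &
        forall k, (2 <= k)%N ->
          Z k = tau k ^ n * hermitian (Z_solid_torus k)
                                      (U k *m Z_solid_torus k)].

Definition degenerate (p : nat) (l : 'I_p) : bool :=
  (val l == 0%N) || (2 * l == p)%N.

Definition m_exp (p : nat) (l : 'I_p) : R :=
  if degenerate l then - (3 / 2) else - (1 / 2).

Definition a_lead (p q : nat) (l : 'I_p) : R[i] :=
  if degenerate l then
    - 'i * (Num.sqrt 2 * pi / (p%:R `^ (3 / 2)))%:C
  else
    (Num.sqrt (2 / p%:R) * sin (2 * pi * q%:R * l%:R / p%:R)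
                         * sin (2 * pi * l%:R / p%:R))%:C.

Definition lens_expansion (p q : nat) (m : int) (a : 'I_p -> nat -> R[i])
    (N k : nat) : R[i] :=
  expi (m%:~R * pi / 4) *
  \sum_(l < p) (k%:R `^ m_exp l)%:C
    * expi (2 * pi * (q%:R * l%:R ^+ 2 / p%:R) * k%:R)
    * \sum_(n < N.+1) a l n * k%:R ^- n.

End TorusTQFT.

(* Main.v *)
Require Import Defs.
From mathcomp Require Import ring lra zify.

(** Write cis t for e^(i pi t).  On the coordinates c = j - 1 of V_k(T^2), S is
    the sine transform and T multiplies by a Gaussian phase, so the image of the
    empty skein under a word in S and T ought to be an explicit Gaussian sum.
    To a primitive vector (x, y) attach [curve_vec k x y], whose coordinate of
    index c = j - 1 is, up to normalisation,
      sum_(l mod x) cis (y J^2 / (2 k x)) sin (pi J / (k x)),  J = j + 2 k l.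
    The point is that, on complex conjugates and up to a scalar
    cis (r / 4 + s / k) with r an integer and s a real number independent of k,
    T maps the vector of (x, y) to that of
    (x, x + y) and S maps it to that of (- y, x) ([twist_family],
    [S_action_family]).  The first is immediate; the second is the reciprocity
    law [gauss_reciprocity] for quadratic Gauss sums, applied after unfolding
    the sum over the colours j and the sum over l into one sum over residues
    modulo 2 k x.  Hence, by induction on the word ([implements_mcg]), the
    conjugate of U e_0 is the vector of the curve (p, q), up to such a scalar;
    the anomaly is also a scalar of this kind, so Z_k is such a scalar times the
    coordinate of index 0 of the vector of (p, q) ([Z_lensE]).

    Reciprocity with its exact phase, uniformly in k, is the arithmetic heart.
    A common divisor of the two moduli factors out of both sides ([gauss_gcd]).
    For coprime moduli the Chinese remainder theorem multiplies the two sums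
    into one classical sum theta_sum(N) = sum_(r mod 4 N) cis (r^2 / 4 N), and the
    modulus of each factor is elementary.  The value theta_sum(N) = sqrt N theta_sum(1)
    is found without Fourier analysis ([theta_sqrt]): theta_sum(N m^2) = m theta_sum(N)
    holds exactly, while cutting off the oscillating tail by partial summation
    shows that theta_sum varies slowly, so that comparing theta_sum(N m^2) with
    theta_sum(m'^2), for m' the integer part of m sqrt N and m large, gives the
    claim in the limit.

    At j = 1 the l-th summand carries the phase cis (2 q l^2 k / p), and the
    remaining factor is a combination of cis (b / k) for constants b.  After
    averaging the terms of l and - l, which carry the same phase, the Taylor
    series of cis yields the expansion in 1 / k with the stated leading
    coefficients ([amplitude_expansion], [lens_coef0]).  For l = 0 or l = p / 2
    the constant term of the series cancels, which accounts for the exponent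
    - 3 / 2. *)

Set Implicit Arguments.
Unset Strict Implicit.
Unset Printing Implicit Defensive.

Import Normc.

Local Open Scope classical_set_scope.
Local Open Scope ring_scope.
Local Open Scope complex_scope.

(** * Exponentials and sums over residue classes *)

Section Cis.
Context {R : realType}.
Implicit Types (s t : R) (z : int) (n : nat).

(** The period of cis is 2, so that identities between cis values become
    congruences between rational numbers modulo even integers ([cis_eq]). *)
Definition cis t : R[i] := expi (pi * t).

Lemma expiD s t : expi (s + t) = expi s * expi t.
Proof. by rewrite /expi cosD sinD; simpc; congr (_ +i* _); ring. Qed.

Lemma expi0 : expi 0 = 1 :> R[i].
Proof. by rewrite /expi cos0 sin0. Qed.

Lemma conj_expi t : (expi t)^* = expi (- t).
Proof. by rewrite /expi cosN sinN. Qed.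

Lemma normr_expi t : `|expi t| = 1.
Proof. by rewrite normc_def /= cos2Dsin2 sqrtr1. Qed.

Lemma cisD s t : cis (s + t) = cis s * cis t.
Proof. by rewrite /cis mulrDr expiD. Qed.

Lemma cis0 : cis 0 = 1.
Proof. by rewrite /cis mulr0 expi0. Qed.

Lemma conjcM (u v : R[i]) : (u * v)^*%C = u^*%C * v^*%C.
Proof. exact: rmorphM. Qed.

Lemma conjc_sum (I : Type) (r : seq I) (P : pred I) (F : I -> R[i]) :
  (\sum_(i <- r | P i) F i)^*%C = \sum_(i <- r | P i) (F i)^*%C.
Proof. exact: rmorph_sum. Qed.

Lemma conj_cis t : (cis t)^* = cis (- t).
Proof. by rewrite /cis conj_expi mulrN. Qed.

Lemma normr_cis t : `|cis t| = 1.
Proof. exact: normr_expi. Qed.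

Lemma cis_neq0 t : cis t != 0.
Proof. by rewrite -normr_eq0 normr_cis oner_eq0. Qed.

Lemma cisNK t : cis (- t) * cis t = 1.
Proof. by rewrite -cisD addNr cis0. Qed.

Lemma cisN t : cis (- t) = (cis t)^-1.
Proof. by apply: (mulIf (cis_neq0 t)); rewrite cisNK mulVf ?cis_neq0. Qed.

Lemma cisX t n : cis t ^+ n = cis (n%:R * t).
Proof.
elim: n => [|n IH]; first by rewrite expr0 mul0r cis0.
by rewrite exprS IH -cisD; congr cis; rewrite -natr1; ring.
Qed.

Lemma cis1 : cis 1 = -1.
Proof. by rewrite /cis /expi mulr1 cospi sinpi; simpc. Qed.

Lemma cis_even_int z : cis (2 * z%:~R) = 1.
Proof.
have c2 n : cis (2 * n%:R) = 1.
  by rewrite mulrC -cisX -[2]/(1 + 1) cisD cis1 mulrNN mulr1 expr1n.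
case: z => n; first exact: c2.
by rewrite NegzE mulrNz mulrN cisN c2 invr1.
Qed.

Lemma cis_eq s t z : s = t + 2 * z%:~R -> cis s = cis t.
Proof. by move=> ->; rewrite cisD cis_even_int mulr1. Qed.

Lemma cis_sin t : cis t - cis (- t) = 2 * 'i%C * (sin (pi * t))%:C.
Proof.
rewrite -conj_cis /cis /expi -mulrA mulr_natl mulr2n; simpc.
by [].
Qed.

Lemma cis_cos t : cis t + cis (- t) = 2 * (cos (pi * t))%:C.
Proof.
rewrite -conj_cis /cis /expi mulr_natl mulr2n; simpc.
by [].
Qed.

Lemma cis_half : cis (1 / 2) = 'i%C.
Proof. by rewrite /cis mul1r /expi cos_pihalf sin_pihalf. Qed.

Lemma cis_eq1 t : 0 < t < 2 -> cis t != 1.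
Proof.
move=> /andP[t0 t2]; apply/negP => /eqP h.
have h2 : cis (t / 2) - cis (- (t / 2)) = 0.
  apply: (mulfI (cis_neq0 (t / 2))); rewrite mulrBr -!cisD mulr0 subrr cis0.
  by rewrite -splitr h subrr.
have /lt0r_neq0/eqP : 0 < sin (pi * (t / 2)).
  apply: sin_gt0_pi; rewrite mulr_gt0 ?pi_gt0 ?divr_gt0 //=.
  by rewrite gtr_pMr ?pi_gt0 // ltr_pdivrMr // mul1r.
apply; move: h2; rewrite cis_sin => /eqP; rewrite !mulf_eq0 pnatr_eq0 /=.
by case/orP; rewrite eq_complex /= ?eqxx ?oner_eq0 ?andbF ?andbT // => /eqP.
Qed.

End Cis.

Section ResidueSums.
Context {V : nmodType}.
Implicit Types (f : int -> V) (c : nat) (z : int).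

Definition zperiodic c f := forall z, f (z + c%:Z) = f z.

Lemma zperiodicM c f z w : zperiodic c f -> f (z + w * c%:Z) = f z.
Proof.
move=> fc.
have up n y : f (y + n%:Z * c%:Z) = f y.
  elim: n => [|n IH]; first by rewrite mul0r addr0.
  by rewrite -addn1 PoszD mulrDl mul1r addrA fc.
case: w => n; first exact: up.
by rewrite -(up n.+1) NegzE mulNr addrNK.
Qed.

Lemma modz_ord c (n : 'I_c) : (n%:Z %% c%:Z)%Z = n%:Z.
Proof. by rewrite modz_small // lez_nat ltz_nat ltn_ord. Qed.

(** Two integers congruent modulo c have the same image by f, and by counting
    s meets every class: it may replace the representatives 0, ..., c - 1. *)
Lemma sum_residues (I : finType) c f (s : I -> int) :
  (0 < c)%N -> #|I| = c -> zperiodic c f ->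
  (forall i j, (s i = s j %[mod c%:Z])%Z -> i = j) ->
  \sum_i f (s i) = \sum_(n < c) f n.
Proof.
case: c => // c _ cardI fc sI.
pose h i : 'I_c.+1 := inord `|(s i %% c.+1%:Z)%Z|%N.
have hE i : (h i)%:Z = (s i %% c.+1%:Z)%Z.
  have ge0 : (0 <= s i %% c.+1%:Z)%Z by rewrite modz_ge0.
  rewrite /h inordK -?[(`|_|%N)%:Z]/(`|_|%N%:Z) ?gez0_abs //.
  by rewrite -ltz_nat gez0_abs // ltz_pmod.
have hI : injective h by move=> i j /(congr1 val) e; apply: sI; rewrite -!hE; congr Posz.
have hb : bijective h by apply: inj_card_bij => //; rewrite cardI card_ord.
rewrite (reindex h); last exact: onW_bij.
apply: eq_bigr => i _; rewrite hE.
by rewrite [in LHS](divz_eq (s i) c.+1) addrC zperiodicM.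
Qed.

Lemma sum_residues_shift c f t : zperiodic c f ->
  \sum_(n < c) f (n%:Z + t) = \sum_(n < c) f n.
Proof.
case: c => [|c] fc; first by rewrite !big_ord0.
apply: (@sum_residues _ c.+1 f (fun n : 'I_c.+1 => n%:Z + t)) => //.
  by rewrite card_ord.
move=> i j /eqP; rewrite eqz_modDr => /eqP; rewrite !modz_ord.
by case=> /val_inj.
Qed.

Lemma sum_residues_opp c f : zperiodic c f ->
  \sum_(n < c) f (- n%:Z) = \sum_(n < c) f n.
Proof.
case: c => [|c] fc; first by rewrite !big_ord0.
apply: (@sum_residues _ c.+1 f (fun n : 'I_c.+1 => - n%:Z)) => //.
  by rewrite card_ord.
move=> i j /eqP; rewrite eqz_mod_dvd opprK addrC -eqz_mod_dvd eq_sym => /eqP.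
by rewrite !modz_ord => -[] /val_inj.
Qed.

(** For coprime a and c, a n + c m meets each class modulo a c once. *)
Lemma sum_residues_crt a c f : coprime a c -> (0 < a)%N -> (0 < c)%N ->
  zperiodic (a * c) f ->
  \sum_(n < c) \sum_(m < a) f (a%:Z * n%:Z + c%:Z * m%:Z)
    = \sum_(M < a * c) f M.
Proof.
move=> co a0 c0 fc; rewrite pair_big /=.
apply: (@sum_residues _ _ f
  (fun u : 'I_c * 'I_a => a%:Z * u.1%:Z + c%:Z * u.2%:Z)) => //.
- by rewrite muln_gt0 a0.
- by rewrite card_prod !card_ord mulnC.
have key (x y : nat) (n n' : 'I_x) (m m' : 'I_y) : coprime y x ->
    (y%:Z * n%:Z + x%:Z * m%:Z = y%:Z * n'%:Z + x%:Z * m'%:Z %[mod (y * x)%N%:Z])%Z ->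
    n = n'.
  move=> coyx /eqP; rewrite eqz_mod_dvd => h; apply: val_inj => /=.
  have : (x%:Z %| y%:Z * (n%:Z - n'%:Z))%Z.
    have -> : y%:Z * (n%:Z - n'%:Z) =
      (y%:Z * n%:Z + x%:Z * m%:Z - (y%:Z * n'%:Z + x%:Z * m'%:Z))
        + x%:Z * (m'%:Z - m%:Z) by ring.
    rewrite rpredD ?dvdz_mulr //.
    by apply: dvdz_trans h; rewrite PoszM dvdz_mull.
  rewrite Gauss_dvdzr; last by rewrite coprimezE /= coprime_sym.
  by rewrite -eqz_mod_dvd !modz_ord => /eqP[].
move=> [n m] [n' m'] /= h; congr pair; first exact: (key c a n n' m m').
apply: (key a c m m' n n'); first by rewrite coprime_sym.
by rewrite mulnC addrC [RHS in (_ = RHS %[mod _])%Z]addrC.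
Qed.

End ResidueSums.

(** * Quadratic Gauss sums *)

(** Euclidean division of J by c as a bijection. *)
Lemma sum_blocks {V : nmodType} (F : nat -> V) d c :
  \sum_(J < d * c) F J = \sum_(n < c) \sum_(t < d) F (n + c * t)%N.
Proof.
rewrite exchange_big /=; elim: d => [|d IH]; first by rewrite !big_ord0.
rewrite big_ord_recr /= -IH mulSn addnC big_split_ord /=; congr (_ + _).
by apply: eq_bigr => i _; rewrite mulnC addnC.
Qed.

Lemma sqrn_bin2 n : (n ^ 2 = n + 2 * 'C(n, 2))%N.
Proof.
rewrite mul2n bin2 halfK; case: n => // n.
by rewrite oddM /= andNb subn0 -mulnS mulnn.
Qed.

Section GaussSums.
Context {R : realType}.
Implicit Types (a c d n : nat) (b t w z : int).

Lemma unity_sum n t : (0 < n)%N ->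
  \sum_(m < n) cis (2 * t%:~R * m%:R / n%:R : R)
    = if (n %| t)%Z then n%:R else 0.
Proof.
move=> n0; have nR : n%:R != 0 :> R by rewrite pnatr_eq0 -lt0n.
case: ifP => [/dvdzP[w ->]|ndvd].
  rewrite (eq_bigr (fun=> 1)) => [|m _]; first by rewrite sumr_const card_ord.
  rewrite -(cis_even_int (w * m%:Z)); congr cis.
  by rewrite !intrM -!pmulrn; field.
pose x : R[i] := cis (2 * t%:~R / n%:R : R).
have xE m : cis (2 * t%:~R * m%:R / n%:R : R) = x ^+ m.
  by rewrite cisX; congr cis; ring.
rewrite (eq_bigr (fun m : 'I_n => x ^+ m)) => [|m _]; last exact: xE.
have x1 : x - 1 != 0.
  rewrite subr_eq0 /x.
  pose r := (t %% n%:Z)%Z.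
  have rE : t = (t %/ n%:Z)%Z * n%:Z + r by rewrite -divz_eq.
  rewrite (@cis_eq _ _ (2 * r%:~R / n%:R) (t %/ n%:Z)%Z); last first.
    by rewrite {1}rE intrD intrM -!pmulrn; field.
  apply: cis_eq1.
  have r0 : (0 <= r)%R by rewrite modz_ge0 // eqz_nat -lt0n.
  have r1 : (r != 0)%R by apply/negP => /eqP h; move/negP: ndvd; apply; apply/dvdz_mod0P.
  have rn : (r < n%:Z)%R by rewrite ltz_pmod.
  have rR : 0 < r%:~R :> R by rewrite ltr0z lt_neqAle eq_sym r1.
  rewrite divr_gt0 ?mulr_gt0 ?ltr0n //= ltr_pdivrMr ?ltr0n //.
  by rewrite ltr_pM2l // pmulrn ltr_int.
apply: (mulfI x1); rewrite -subrX1 -xE mulr0.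
rewrite -(mulfK nR (2 * t%:~R)) in x1 *.
by rewrite divfK // mulfK // cis_even_int subrr.
Qed.

Definition gauss_term a b c z : R[i] :=
  cis ((a%:R * z%:~R ^+ 2 + b%:~R * z%:~R) / c%:R).

Definition gauss_sum a b c : R[i] := \sum_(n < c) gauss_term a b c n%:Z.

(** The parity of a c + b is exactly what makes the quadratic exponent
    well defined modulo 2 on residues modulo c. *)
Lemma gauss_term_periodic a b c : (0 < c)%N -> (2 %| (a * c)%N%:Z + b)%Z ->
  zperiodic c (gauss_term a b c).
Proof.
move=> c0 /dvdzP[w e] z; have cR : c%:R != 0 :> R by rewrite pnatr_eq0 -lt0n.
apply: (@cis_eq _ _ _ (a%:Z * z + w)).
have /(congr1 (fun x : int => x%:~R : R)) := e.
rewrite !(intrD, intrM, natrM, PoszM) -!pmulrn => eR.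
have -> : b%:~R = w%:~R * 2 - a%:R * c%:R :> R by rewrite -eR; ring.
by field.
Qed.

Lemma gauss_opp a b c : (2 %| (a * c)%N%:Z + b)%Z -> gauss_sum a (- b) c = gauss_sum a b c.
Proof.
case: c => [|c] p; first by rewrite /gauss_sum !big_ord0.
rewrite /gauss_sum -(sum_residues_opp (gauss_term_periodic _ p)) //.
by apply: eq_bigr => n _; rewrite /gauss_term !mulrNz sqrrN mulrN mulNr.
Qed.

(** Expanding the square and substituting n + m for n leaves a geometric sum
    in m, which vanishes unless c divides a n, that is n = 0. *)
Lemma gauss_normr a b c : (0 < c)%N -> coprime a c ->
  (2 %| (a * c)%N%:Z + b)%Z -> gauss_sum a b c * (gauss_sum a b c)^*%C = c%:R.
Proof.
move=> c0 co p; have cR : c%:R != 0 :> R by rewrite pnatr_eq0 -lt0n.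
have per := gauss_term_periodic c0 p.
rewrite {2}/gauss_sum rmorph_sum mulr_sumr.
under eq_bigr => m _.
  rewrite {1}/gauss_sum -(sum_residues_shift m%:Z per) mulr_suml.
  under eq_bigr => n _.
    have -> : gauss_term a b c (n%:Z + m%:Z) * (gauss_term a b c m%:Z)^*%C =
       gauss_term a b c n * cis (2 * (a%:Z * n%:Z)%:~R * m%:R / c%:R : R).
      rewrite /gauss_term conj_cis -!cisD; congr cis.
      by rewrite !(intrM, intrD) -!pmulrn; field.
    over.
  over.
rewrite exchange_big /=.
under eq_bigr => n _ do rewrite -mulr_sumr unity_sum //.
case: c c0 cR co p per => // c _ cR co p per.
rewrite (bigD1 ord0) //= big1 => [|n n0].
  have -> : gauss_term a b c.+1 0 = 1 by rewrite /gauss_term expr0n !mulr0 addr0 mul0r cis0.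
  by rewrite mulr0 dvdz0 mul1r addr0.
case: ifP => [|_]; last by rewrite mulr0.
rewrite Gauss_dvdzr; last by rewrite coprimezE /= coprime_sym.
rewrite /dvdz /= => /dvdn_leq; rewrite lt0n -val_eqE in n0 *.
by move=> /(_ n0); rewrite leqNgt ltn_ord.
Qed.

(** Modulo even integers, (a n + c m)^2 / (a c) splits as
    a n^2 / c + c m^2 / a. *)
Lemma gauss_mul a b c : (0 < a)%N -> (0 < c)%N -> coprime a c ->
  (2 %| (a * c)%N%:Z + b)%Z ->
  gauss_sum a b c * gauss_sum c b a = gauss_sum 1 b (a * c)%N.
Proof.
move=> a0 c0 co p.
have aR : a%:R != 0 :> R by rewrite pnatr_eq0 -lt0n.
have cR : c%:R != 0 :> R by rewrite pnatr_eq0 -lt0n.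
rewrite {3}/gauss_sum -(sum_residues_crt co) //; last first.
  by apply: gauss_term_periodic; rewrite ?mul1n // muln_gt0 a0.
rewrite /gauss_sum mulr_suml; apply: eq_bigr => n _.
rewrite mulr_sumr; apply: eq_bigr => m _.
rewrite /gauss_term -cisD; apply/esym/(@cis_eq _ _ _ (n%:Z * m%:Z)).
by rewrite !(intrD, intrM, natrM) -!pmulrn; field; apply/andP.
Qed.

(** Writing the index as n + c t with t < d, the sum over t is geometric: it
    either is d or annihilates the whole Gauss sum.  The criterion, d | w, is
    symmetric in a and c, hence holds on both sides of the reciprocity law. *)
Lemma gauss_gcd d a b c w : (0 < d)%N -> (0 < c)%N ->
  (a * c * d)%N%:Z + b = 2 * w ->
  gauss_sum (d * a) b (d * c) =
    if (d %| w)%Z then d%:R * gauss_sum a (b %/ d)%Z c else 0.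
Proof.
move=> d0 c0 e.
have dR : d%:R != 0 :> R by rewrite pnatr_eq0 -lt0n.
have cR : c%:R != 0 :> R by rewrite pnatr_eq0 -lt0n.
have /(congr1 (fun x : int => x%:~R : R)) := e.
rewrite !(intrD, intrM, natrM, PoszM) -!pmulrn => eR.
have bR : b%:~R = 2 * w%:~R - a%:R * c%:R * d%:R :> R by rewrite -eR; ring.
have blk n (t : nat) : gauss_term (d * a) b (d * c) (n + c * t)%N%:Z =
   gauss_term (d * a) b (d * c) n%:Z * cis (2 * w%:~R * t%:R / d%:R : R).
  (* t ^ 2 and t have the same parity *)
  rewrite /gauss_term -cisD.
  apply: (@cis_eq _ _ _ (a%:Z * n%:Z * t%:Z + a%:Z * c%:Z * 'C(t, 2)%:Z)).
  have tR : t%:R ^+ 2 = t%:R + 2 * 'C(t, 2)%:R :> R.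
    by rewrite -natrX -natrM -natrD sqrn_bin2.
  rewrite !(intrD, intrM, natrM, PoszM, PoszD) -!pmulrn bR.
  have -> : (n%:R + c%:R * t%:R) ^+ 2 = n%:R ^+ 2 + 2 * n%:R * c%:R * t%:R
     + c%:R ^+ 2 * (t%:R + 2 * 'C(t, 2)%:R) :> R by rewrite -tR; ring.
  by field; apply/andP.
rewrite {1}/gauss_sum (sum_blocks (fun J => gauss_term _ _ _ J%:Z)).
under eq_bigr => n _.
  under eq_bigr => t _ do rewrite blk.
  rewrite -mulr_sumr unity_sum //; over.
case: ifP => [dw|_]; last by rewrite big1 // => n _; rewrite mulr0.
rewrite -mulr_suml mulrC; congr (_ * _); apply: eq_bigr => n _.
have db : (d %| b)%Z.
  have -> : b = 2 * w - (a * c)%N%:Z * d%:Z by rewrite -e PoszM; ring.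
  by rewrite rpredB ?dvdz_mull.
rewrite /gauss_term -{1}(divzK db) natrM intrM -pmulrn; congr cis.
by rewrite natrM -!pmulrn; field; apply/andP.
Qed.

End GaussSums.

(** * Taylor bounds and the complex modulus *)

Section Taylor.
Context {R : realType}.
Implicit Types (s t x : R) (N : nat).

Definition taylor_cos s N : {poly R} :=
  \poly_(n < N) (cos (s + n%:R * (pi / 2)) / n`!%:R).

Lemma deriv_taylor_cos s N :
  (taylor_cos s N.+1)^`() = taylor_cos (s + pi / 2) N.
Proof.
apply/polyP => i; rewrite coef_deriv !coef_poly ltnS.
case: ifP => _; last by rewrite mul0rn.
have -> : s + pi / 2 + i%:R * (pi / 2) = s + i.+1%:R * (pi / 2) :> R.
  by rewrite -natr1; ring.
rewrite -mulr_natr factS natrM; field.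
by rewrite addrC natr1 !pnatr_eq0 -lt0n fact_gt0.
Qed.

(** The phase s is kept general because differentiating shifts it by pi / 2;
    the mean value theorem then gives the induction on N. *)
Lemma taylor_cos_bound N s x :
  `|cos (s + x) - (taylor_cos s N).[x]| <= `|x| ^+ N.
Proof.
elim: N s x => [|N IH] s x.
  by rewrite expr0 /taylor_cos poly_def big_ord0 horner0 subr0 cos_max.
pose F := (cos \o (fun y => s + y)) - horner (taylor_cos s N.+1).
pose dF y := - sin (s + y) - (taylor_cos (s + pi / 2) N).[y].
have FD y : is_derive y (1 : R) F (dF y).
  apply: is_deriveB; last by rewrite -deriv_taylor_cos; exact: is_derive_poly.
  have D : is_derive y (1 : R) (fun z => s + z) 1.
    have := is_deriveD (is_derive_cst s y (1 : R)) (is_derive_id y (1 : R)).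
    by rewrite add0r.
  by have := is_derive1_comp (is_derive_cos (s + y)) D; rewrite mulr1.
have F0 : F 0 = 0.
  rewrite /F !fctE /= addr0 horner_coef0 coef_poly /= mul0r addr0 fact0.
  by rewrite divr1 subrr.
have dFE y : dF y = cos (s + pi / 2 + y) - (taylor_cos (s + pi / 2) N).[y].
  by rewrite /dF -cosDpihalf addrAC.
have cF a b : {within `[a, b], continuous F}.
  apply: continuous_subspaceT => y.
  by apply: differentiable_continuous; apply/derivable1_diffP; apply: ex_derive.
have bound y : `|y| <= `|x| -> `|dF y| <= `|x| ^+ N.
  by move=> yx; rewrite dFE (le_trans (IH _ _)) // lerXn2r ?nnegrE ?normr_ge0.
suff [y yx e] : exists2 y, `|y| <= `|x| & F x = dF y * x.
  by rewrite -[X in `|X|]/(F x) e normrM exprSr ler_wpM2r // bound.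
have [x0|x0] := leP 0 x.
  have [y /[!in_itv]/= /andP[y0 yx] e] := MVT_segment x0 (fun y _ => FD y) (@cF _ _).
  exists y; first by rewrite !ger0_norm.
  by move: e; rewrite F0 !subr0.
have [y /[!in_itv]/= /andP[y0 yx] e] := MVT_segment (ltW x0) (fun y _ => FD y) (@cF _ _).
exists y; first by rewrite !ler0_norm ?lerN2 // ltW.
by move: e; rewrite F0 !sub0r mulrN => /oppr_inj.
Qed.

Lemma normc_le (z : R[i]) : normc z <= `|complex.Re z| + `|complex.Im z|.
Proof.
case: z => a b; rewrite -[leLHS]ger0_norm; last by rewrite sqrtr_ge0.
rewrite -[leRHS]ger0_norm; last by rewrite addr_ge0.
rewrite -ler_sqr ?nnegrE // !real_normK ?num_real //= sqr_sqrtr; last nra.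
rewrite sqrrD !real_normK ?num_real //.
by have := normr_ge0 a; have := normr_ge0 b; nra.
Qed.

Lemma normc_sum (I : Type) (r : seq I) (P : pred I) (F : I -> R[i]) :
  normc (\sum_(i <- r | P i) F i) <= \sum_(i <- r | P i) normc (F i).
Proof.
elim/big_ind2: _ => [|z a w b za wb|//]; first by rewrite normc0.
by rewrite (le_trans (le_normcD _ _)) ?lerD.
Qed.

Lemma normc_real t : normc t%:C = `|t|.
Proof. by rewrite /normc /= expr0n addr0 sqrtr_sqr. Qed.

Lemma normc_nat n : normc (n%:R : R[i]) = n%:R.
Proof. by rewrite -(rmorph_nat (real_complex R)) normc_real ger0_norm. Qed.

Lemma normc_expi t : normc (expi t) = 1.
Proof. by rewrite /normc /= cos2Dsin2 sqrtr1. Qed.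

Lemma normc_cis t : normc (cis t) = 1.
Proof. exact: normc_expi. Qed.

Lemma normc_ge0 (z : R[i]) : 0 <= normc z.
Proof. by case: z => a b; rewrite sqrtr_ge0. Qed.

Lemma normcE (z : R[i]) : `|z| = (normc z)%:C.
Proof. by []. Qed.

(** This is i^n / n!. *)
Definition expi_coef (n : nat) : R[i] := cis (n%:R / 2) / n`!%:R.

Lemma taylor_expi_bound N x :
  normc (expi x - \sum_(n < N) expi_coef n * (x%:C) ^+ n) <= 2 * `|x| ^+ N.
Proof.
have -> : expi x - \sum_(n < N) expi_coef n * x%:C ^+ n =
   (cos (0 + x) - (taylor_cos 0 N).[x]) +i*
   (cos (- (pi / 2) + x) - (taylor_cos (- (pi / 2)) N).[x]).
  have -> : \sum_(n < N) expi_coef n * x%:C ^+ n =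
      (taylor_cos 0 N).[x] +i* (taylor_cos (- (pi / 2)) N).[x].
    rewrite /taylor_cos !horner_poly; elim: N => [|N IH]; first by rewrite !big_ord0.
    rewrite !big_ord_recr /= IH; simpc.
    have -> : expi_coef N * x%:C ^+ N =
        (cos (0 + N%:R * (pi / 2)) / N`!%:R * x ^+ N) +i*
        (cos (- (pi / 2) + N%:R * (pi / 2)) / N`!%:R * x ^+ N).
      rewrite /expi_coef /cis /expi -(rmorph_nat (real_complex R)) -fmorphV.
      rewrite -rmorphXn /=; simpc.
      rewrite [- (pi / 2) + _]addrC cosBpihalf ?add0r.
      by have -> : N%:R * (pi / 2) = pi * (N%:R / 2) :> R by ring.
    by simpc.
  by rewrite add0r [- (pi / 2) + _]addrC cosBpihalf /expi; simpc.
rewrite (le_trans (normc_le _)) //= mulr_natl mulr2n.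
by rewrite lerD ?taylor_cos_bound.
Qed.

Lemma expi_lip s t : normc (expi s - expi t) <= 2 * `|s - t|.
Proof.
have -> : expi s - expi t = expi t * (expi (s - t) - 1).
  by rewrite mulrBr -expiD mulr1 [t + _]addrC subrK.
rewrite normcM normc_expi mul1r.
have := taylor_expi_bound 1 (s - t).
rewrite big_ord1 expr0 mulr1 /expi_coef mul0r cis0 fact0 divr1 expr1.
by [].
Qed.

(** A crude form of Jordan's inequality.  Taylor's bound settles x <= 1 / 2, and
    beyond that point monotonicity suffices because pi / 2 < 2. *)
Lemma sin_ge x : 0 <= x <= pi / 2 -> x / 8 <= sin x.
Proof.
move=> /andP[x0 xpi].
have small (y : R) : 0 <= y <= 1 / 2 -> 3 / 4 * y <= sin y.
  move=> /andP[y0 y1].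
  have := taylor_cos_bound 3 (- (pi / 2)) y.
  rewrite [- _ + y]addrC cosBpihalf horner_poly !big_ord_recl big_ord0 /= /bump /=.
  have -> : - (pi / 2) + 1%:R * (pi / 2) = 0 :> R by ring.
  have -> : - (pi / 2) + (1 + 1)%N%:R * (pi / 2) = pi / 2 :> R by ring.
  rewrite mul0r addr0 cosN cos_pihalf cos0 !fact0 !mul0r !add0r expr1 !addr0.
  rewrite divr1 mul1r (ger0_norm y0) ler_norml => /andP[+ _].
  by rewrite !exprS expr0; nra.
have [xs|xl] := leP x (1 / 2).
  by apply: le_trans (small x _); [lra|rewrite x0].
have h : 3 / 4 * (1 / 2) <= sin (1 / 2 : R) by apply: small; lra.
have pi2 : pi / 2 < 2 :> R by have /andP[] := @pihalf_02 R.
have m : sin (1 / 2 : R) < sin x.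
  by rewrite ltr_sin // ?in_itv /=; lra.
lra.
Qed.

End Taylor.

(** * The value of the classical quadratic Gauss sum *)

Section Theta.
Context {R : realType}.
Implicit Types (s t x : R) (i K L M N X m n : nat).

Definition theta_term K M : R[i] := cis (M%:R ^+ 2 / (2 * K%:R)).

Definition theta_sum N : R[i] := \sum_(r < 4 * N) theta_term (2 * N) r.

Lemma theta1 : theta_sum 1 = 2 * cis (1 / 4).
Proof.
rewrite /theta_sum !big_ord_recl big_ord0 /= /bump /= /theta_term.
have -> : 0%:R ^+ 2 / (2 * (2 * 1)%N%:R) = 0 :> R by rewrite expr0n mul0r.
have -> : 1%:R ^+ 2 / (2 * (2 * 1)%N%:R) = 1 / 4 :> R by field.
have -> : (1 + 1)%N%:R ^+ 2 / (2 * (2 * 1)%N%:R) = 1 :> R by field.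
have -> : (1 + (1 + 1))%N%:R ^+ 2 / (2 * (2 * 1)%N%:R) = 1 / 4 + 2 * 1%:~R :> R by field.
by rewrite cisD cis_even_int cis1 cis0; ring.
Qed.

(** In blocks of length 4 N m the inner sum is geometric and keeps only the
    multiples of m. *)
Lemma theta_scale N m : (0 < N)%N -> (0 < m)%N ->
  theta_sum (N * m ^ 2) = m%:R * theta_sum N.
Proof.
move=> N0 m0.
have NR : N%:R != 0 :> R by rewrite pnatr_eq0 -lt0n.
have mR : m%:R != 0 :> R by rewrite pnatr_eq0 -lt0n.
rewrite /theta_sum.
have -> : (4 * (N * m ^ 2) = m * (4 * N * m))%N by ring.
rewrite sum_blocks.
have blk n (t : nat) : theta_term (2 * (N * m ^ 2)) (n + 4 * N * m * t) =
  theta_term (2 * (N * m ^ 2)) n * cis (2 * n%:Z%:~R * t%:R / m%:R : R).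
  rewrite /theta_term -cisD; apply: (@cis_eq _ _ _ (2 * N%:Z * t%:Z ^+ 2)).
  by rewrite !(intrM, natrM, natrD, natrX, rmorphXn) -!pmulrn /=; field; apply/andP.
under eq_bigr => n _.
  under eq_bigr => t _ do rewrite blk.
  rewrite -mulr_sumr unity_sum //; over.
rewrite (sum_blocks (fun n => theta_term _ n * (if (m %| n%:Z)%Z then _ else _))).
case: m m0 mR blk => // m _ mR _.
rewrite big_ord_recl /= [X in _ + X]big1 => [|i _]; last first.
  apply: big1 => t _; case: ifP; last by rewrite mulr0.
  rewrite dvdzE /= dvdn_addl ?dvdn_mulr // => /dvdn_leq.
  by rewrite /bump /= => /(_ isT); have := ltn_ord i; lia.
rewrite addr0 mulr_sumr; apply: eq_bigr => t _.
rewrite add0n dvdzE /= dvdn_mulr // mulrC; congr (_ * cis _).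
by rewrite !(natrM, natrX); field; apply/andP.
Qed.

(** Summation by parts: the decrements of a nonincreasing weight telescope. *)
Lemma abel_bound n (c : nat -> R) (v : nat -> R[i]) :
  (forall i, normc (v i) <= 1) -> (forall i, (i <= n)%N -> 0 <= c i) ->
  (forall i, (i < n)%N -> c i.+1 <= c i) ->
  normc (\sum_(i < n.+1) (c i)%:C * (v i.+1 - v i)) <= 2 * c 0%N.
Proof.
move=> v1 c0 cm; pose S k := \sum_(i < k) (c i)%:C * (v i.+1 - v i).
have step k : (k <= n)%N ->
  normc (S k.+1 - (c k)%:C * v k.+1) <= 2 * c 0%N - c k.
  elim: k => [|k IH] kn.
    rewrite /S big_ord1 mulrBr addrAC subrr add0r normcN normcM normc_real.
    by rewrite ger0_norm ?c0 //; have := v1 0%N; have := c0 0%N kn; nra.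
  have -> : S k.+2 - (c k.+1)%:C * v k.+2 =
    (S k.+1 - (c k)%:C * v k.+1) + (c k - c k.+1)%:C * v k.+1.
    by rewrite {1}/S big_ord_recr /= -/(S k.+1) rmorphB /=; ring.
  rewrite (le_trans (le_normcD _ _)) // normcM normc_real.
  rewrite ger0_norm; last by rewrite subr_ge0 cm.
  have := IH (ltnW kn); have := v1 k.+1; have := cm k kn; nra.
have -> : \sum_(i < n.+1) (c i)%:C * (v i.+1 - v i) =
   (S n.+1 - (c n)%:C * v n.+1) + (c n)%:C * v n.+1 by rewrite subrK.
rewrite (le_trans (le_normcD _ _)) // normcM normc_real ger0_norm ?c0 //.
have := step n (leqnn n); have := v1 n.+1; have := c0 n (leqnn n); nra.
Qed.

(** With v_M = cis ((M^2 - M) / 2 K), the difference v_(M + 1) - v_M is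
    2 i sin (pi M / 2 K) times the M-th term.  The weight
    1 / sin (pi M / 2 K) decreases for M <= K, so summation by parts bounds the sum by its first value, of order
    K / L. *)
Lemma theta_term_tail K L n : (0 < L)%N -> (L + n <= K)%N ->
  normc (\sum_(i < n) theta_term K (L + i)) <= 8 * K%:R / L%:R.
Proof.
move=> L0 LK; have K0 : (0 < K)%N by lia.
have LR : 0 < L%:R :> R by rewrite ltr0n.
have KR : 0 < K%:R :> R by rewrite ltr0n.
have pi0 := @pi_gt0 R; have pi2 := @pi_ge2 R.
case: n LK => [|n] LK.
  by rewrite big_ord0 normc0 divr_ge0 ?mulr_ge0 ?ler0n.
pose th i : R := pi * ((L + i)%:R / (2 * K%:R)).
pose c i : R := (2 * sin (th i))^-1.
pose v i : R[i] := cis (((L + i)%:R ^+ 2 - (L + i)%:R) / (2 * K%:R)).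
have thE i : th i = pi / 2 * ((L + i)%:R / K%:R) by rewrite /th; field; rewrite gt_eqF.
have thin i : (i <= n)%N -> 0 <= th i <= pi / 2.
  move=> le_in; rewrite thE mulr_ge0 ?divr_ge0 //=; last lra.
  rewrite ger_pMr; last lra.
  by rewrite ler_pdivrMr // mul1r ler_nat; lia.
have sin_lb i : (i <= n)%N -> L%:R / (8 * K%:R) <= sin (th i).
  move=> le_in; apply: le_trans (sin_ge (thin _ le_in)).
  have -> : th i / 8 = pi / 2 * ((L + i)%:R / (8 * K%:R)).
    by rewrite thE; field; rewrite gt_eqF.
  have h : L%:R / (8 * K%:R) <= (L + i)%:R / (8 * K%:R) :> R.
    by rewrite ler_pM2r ?invr_gt0 ?mulr_gt0 // ler_nat leq_addr.
  have h0 : 0 < L%:R / (8 * K%:R) :> R by rewrite divr_gt0 ?mulr_gt0.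
  by nra.
have lb0 : 0 < L%:R / (8 * K%:R) :> R by rewrite divr_gt0 ?mulr_gt0.
have sin_pos i : (i <= n)%N -> 0 < sin (th i).
  by move=> le_in; apply: lt_le_trans lb0 (sin_lb _ le_in).
have termE i : (i <= n)%N ->
    theta_term K (L + i) = 'i%C^-1 * ((c i)%:C * (v i.+1 - v i)).
  move=> le_in; have sn0 := lt0r_neq0 (sin_pos _ le_in).
  have -> : v i.+1 - v i = theta_term K (L + i) * (2 * 'i%C * (sin (th i))%:C).
    rewrite -cis_sin mulrBr -!cisD /v; congr (cis _ - cis _).
      by rewrite addnS -natr1; field; rewrite gt_eqF.
    by field; rewrite gt_eqF.
  have sC : (sin (th i))%:C != 0 :> R[i] by rewrite eq_complex /= negb_and sn0.
  have i0 : 'i%C != 0 :> R[i] by rewrite eq_complex /= oner_eq0 andbF.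
  rewrite /c fmorphV rmorphM /= (rmorph_nat (real_complex R)).
  by field; rewrite sC i0.
rewrite (eq_bigr (fun i : 'I_n.+1 => 'i%C^-1 * ((c i)%:C * (v i.+1 - v i)))).
  have ni : normc ('i%C : R[i]) = 1 by rewrite /normc expr0n expr1n add0r sqrtr1.
  rewrite -mulr_sumr normcM normcV ni invr1 mul1r.
  apply: (@le_trans _ _ (2 * c 0%N)).
    apply: abel_bound.
    - by move=> i; rewrite normc_cis.
    - by move=> i le_in; rewrite invr_ge0 mulr_ge0 // ltW // sin_pos.
    move=> i lt_in; rewrite lef_pV2 ?posrE ?mulr_gt0 ?sin_pos //; last exact: ltnW.
    rewrite ler_pM2l //.
    have [a1 a2] := andP (thin i (ltnW lt_in)).
    have [b1 b2] := andP (thin i.+1 lt_in).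
    apply: ltW; rewrite ltr_sin ?in_itv /=; try lra.
    by rewrite /th ltr_pM2l // ltr_pM2r ?invr_gt0 ?mulr_gt0 // ltr_nat addnS.
  rewrite /c invfM mulrA mulfV // mul1r.
  have -> : 8 * K%:R / L%:R = (L%:R / (8 * K%:R))^-1 :> R.
    by field; rewrite !gt_eqF.
  by rewrite lef_pV2 ?posrE ?sin_pos ?sin_lb.
by move=> i _; apply: termE; rewrite -ltnS.
Qed.

(** The terms of index K + i and K - i coincide, where K = 2 N. *)
Lemma theta_fold N : (0 < N)%N ->
  theta_sum N = 2 * (\sum_(i < 2 * N) theta_term (2 * N) i) - 1 + theta_term (2 * N) (2 * N).
Proof.
move=> N0; rewrite /theta_sum; set K := (2 * N)%N.
have K0 : K%:R != 0 :> R by rewrite pnatr_eq0 muln_eq0 /= -lt0n.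
have -> : (4 * N = K + K)%N by rewrite /K; lia.
rewrite big_split_ord /= [X in _ + X](reindex_inj rev_ord_inj) /=.
have refl i : (i < K)%N -> theta_term K (K + (K - i.+1)) = theta_term K i.+1.
  move=> iK; rewrite /theta_term.
  have -> : (K + (K - i.+1))%N%:R = 2 * K%:R - i.+1%:R :> R.
    by rewrite natrD natrB //; ring.
  apply: (@cis_eq _ _ _ (K%:Z - i.+1%:Z)).
  by rewrite intrD mulrNz -!pmulrn; field.
rewrite [X in _ + X](eq_bigr (fun i : 'I_K => theta_term K i.+1)); last by move=> i _; apply: refl.
have : \sum_(i < K.+1) theta_term K i = \sum_(i < K.+1) theta_term K i by [].
rewrite {1}big_ord_recl big_ord_recr /= => /(canRL (addKr _)) ->.
have -> : theta_term K 0 = 1 by rewrite /theta_term expr0n mul0r cis0.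
by ring.
Qed.

(** The first L terms are compared one by one, and the two oscillating tails
    are bounded separately. *)
Lemma theta_diff N1 N2 L : (0 < N1)%N -> (0 < N2)%N ->
  (0 < L)%N -> (L <= 2 * N1)%N -> (L <= 2 * N2)%N ->
  normc (theta_sum N1 - theta_sum N2) <=
    4 * L%:R ^+ 3 * `|N1%:R^-1 - N2%:R^-1| + 32 * (N1 + N2)%:R / L%:R + 2.
Proof.
move=> N10 N20 L0 LN1 LN2.
have split K (F : nat -> R[i]) : (L <= K)%N ->
   \sum_(i < K) F i = \sum_(i < L) F i + \sum_(i < K - L) F (L + i)%N.
  by move=> LK; rewrite -(subnKC LK) big_split_ord addKn.
have tail N : (L <= 2 * N)%N ->
   normc (\sum_(i < 2 * N - L) theta_term (2 * N) (L + i)) <= 16 * N%:R / L%:R.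
  move=> LN; rewrite (le_trans (theta_term_tail L0 _)) ?subnKC // natrM; lra.
rewrite !theta_fold // (split (2 * N1)%N _ LN1) (split (2 * N2)%N _ LN2).
set a1 := \sum_(i < L) _; set t1 := \sum_(i < _ - L) _.
set a2 := \sum_(i < L) _; set t2 := \sum_(i < _ - L) _.
have -> : 2 * (a1 + t1) - 1 + theta_term (2 * N1) (2 * N1) -
    (2 * (a2 + t2) - 1 + theta_term (2 * N2) (2 * N2)) =
   2%:R * (a1 - a2) + (2%:R * (t1 - t2) +
     (theta_term (2 * N1) (2 * N1) - theta_term (2 * N2) (2 * N2))) by ring.
have tri2 (z w : R[i]) : normc (z - w) <= normc z + normc w.
  by rewrite -[normc w]normcN le_normcD.
have ht : normc (t1 - t2) <= 16 * N1%:R / L%:R + 16 * N2%:R / L%:R.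
  by rewrite (le_trans (tri2 _ _)) // lerD ?tail.
have hq : normc (theta_term (2 * N1) (2 * N1) - theta_term (2 * N2) (2 * N2)) <= 2.
  by rewrite (le_trans (tri2 _ _)) // !normc_cis; lra.
have ha : normc (a1 - a2) <= 2 * L%:R ^+ 3 * `|N1%:R^-1 - N2%:R^-1|.
  rewrite -sumrB (le_trans (normc_sum _ _ _)) //.
  set D : R := `|_|.
  rewrite (@le_trans _ _ (\sum_(i < L) 2 * L%:R ^+ 2 * D)) //; last first.
    by rewrite sumr_const card_ord le_eqVlt; apply/orP; left; apply/eqP; ring.
  apply: ler_sum => i _; rewrite /theta_term /cis (le_trans (expi_lip _ _)) //.
  have -> : pi * (i%:R ^+ 2 / (2 * (2 * N1)%N%:R)) - pi * (i%:R ^+ 2 / (2 * (2 * N2)%N%:R))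
     = (pi / 4) * i%:R ^+ 2 * (N1%:R^-1 - N2%:R^-1) :> R.
    by rewrite !natrM; field; rewrite !pnatr_eq0 -!lt0n N10 N20.
  rewrite normrM ger0_norm; last first.
    by rewrite mulr_ge0 ?exprn_ge0 // divr_ge0 // pi_ge0.
  rewrite mulrA; apply: ler_wpM2r; first exact: normr_ge0.
  have il : i%:R ^+ 2 <= L%:R ^+ 2 :> R.
    by rewrite lerXn2r ?nnegrE ?ler_nat ?ler0n // ltnW.
  have pi4 : pi / 4 <= 1 :> R by have := @pihalf_lt2 R; lra.
  have pi0 := @pi_gt0 R; have i0 : 0 <= i%:R ^+ 2 :> R by rewrite exprn_ge0.
  by nra.
have h2 (z : R[i]) : normc (2%:R * z) = 2 * normc z by rewrite normcM normc_nat.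
rewrite (le_trans (le_normcD _ _)) // h2.
have := le_normcD (2%:R * (t1 - t2)) (theta_term (2 * N1) (2 * N1) - theta_term (2 * N2) (2 * N2)).
rewrite h2 natrD.
have -> : 32 * (N1%:R + N2%:R) / L%:R = 2 * (16 * N1%:R / L%:R + 16 * N2%:R / L%:R) :> R by ring.
by lra.
Qed.

End Theta.

Section ThetaEvaluation.
Context {R : realType}.
Implicit Types (a c d N X m n : nat) (b w z : int).

Lemma succ_sqr_le a n : (0 < n)%N -> (a <= n.+1 ^ 2)%N ->
  (a + n ^ 2 <= 5 * n ^ 2)%N.
Proof. by nia. Qed.

(** Let m' be the integer part of m sqrt N.  Then N m^2 and m'^2 differ by
    O(m), so [theta_diff] with cutoff L = X m' bounds m theta(N) - m' theta(1)
    by a multiple of X^3 + m / X.  Taking m = X^4 and dividing by m leaves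
    O(1 / X) for every X. *)
Lemma theta_sqrt N : (0 < N)%N ->
  theta_sum N = (Num.sqrt N%:R)%:C * theta_sum 1 :> R[i].
Proof.
move=> N0; set s := Num.sqrt _ : R.
have s1 : 1 <= s by rewrite -[1]sqrtr1 ler_sqrt // ler1n.
have ss : s ^+ 2 = N%:R by rewrite sqr_sqrtr.
pose D := normc (theta_sum N - s%:C * theta_sum 1).
have D0 : 0 <= D by apply: normc_ge0.
have key X : (0 < X)%N -> D * X%:R <= 16 + 160 * s.
  move=> X0; have [m mE] : exists m, m = (X ^ 4)%N by exists (X ^ 4)%N.
  pose m' := Num.truncn (s * m%:R).
  have m0 : (0 < m)%N by rewrite mE expn_gt0 X0.
  have mR : 0 < m%:R :> R by rewrite ltr0n.
  have sm0 : 0 <= s * m%:R by rewrite mulr_ge0 //; lra.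
  have /andP[m'le /ltW m'gt] : m'%:R <= s * m%:R < m'.+1%:R by apply: truncn_itv.
  have m'lt : s * m%:R < m'.+1%:R by have /andP[] := truncn_itv sm0.
  have mm' : (m <= m')%N.
    by rewrite -ltnS -(ltr_nat R); apply: le_lt_trans m'lt; nra.
  have Xm : (X <= m)%N by rewrite mE -{1}(expn1 X) leq_pexp2l.
  have m'0 : (0 < m')%N by lia.
  have N1le : (N * m ^ 2 <= m'.+1 ^ 2)%N.
    by rewrite -(ler_nat R) natrM !natrX -ss -exprMn lerXn2r ?nnegrE.
  have N1ge : (m' ^ 2 <= N * m ^ 2)%N.
    by rewrite -(ler_nat R) natrM !natrX -ss -exprMn lerXn2r ?nnegrE.
  have := @theta_diff R (N * m ^ 2) (1 * m' ^ 2) (X * m').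
  rewrite !theta_scale // mul1n.
  have Nm0 : (0 < N * m ^ 2)%N by rewrite muln_gt0 N0 expn_gt0 m0.
  have mm0 : (0 < m' ^ 2)%N by rewrite expn_gt0 m'0.
  have Xm0 : (0 < X * m')%N by rewrite muln_gt0 X0.
  rewrite Nm0 mm0 Xm0.
  have L2 : (X * m' <= 2 * m' ^ 2)%N by nia.
  have -> : (X * m' <= 2 * (N * m ^ 2))%N by nia.
  rewrite L2 => /(_ isT isT isT isT isT) h.
  have m'R : 1 <= m'%:R :> R by rewrite ler1n.
  have XR : 1 <= X%:R :> R by rewrite ler1n.
  have e1 : 4 * (X * m')%:R ^+ 3 * `|(N * m ^ 2)%:R^-1 - (m' ^ 2)%:R^-1| <= 12 * X%:R ^+ 3 :> R.
    have n1 : 0 < (N * m ^ 2)%:R :> R by rewrite ltr0n.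
    have n2 : 0 < (m' ^ 2)%:R :> R by rewrite ltr0n.
    rewrite ler0_norm; last by rewrite subr_le0 lef_pV2 ?posrE // ler_nat.
    rewrite opprB.
    have subV (x y : R) : 0 < x -> 0 < y -> x^-1 - y^-1 = (y - x) / (x * y).
      by move=> x0 y0; field; rewrite !gt_eqF.
    rewrite subV // mulrA ler_pdivrMr ?mulr_gt0 //.
    have u1 : (N * m ^ 2)%:R - (m' ^ 2)%:R <= 3 * m'%:R :> R.
      have : (N * m ^ 2)%:R <= (m'.+1 ^ 2)%:R :> R by rewrite ler_nat.
      by rewrite !natrX -natr1; nra.
    have u2 : (m' ^ 2)%:R <= (N * m ^ 2)%:R :> R by rewrite ler_nat.
    apply: (@le_trans _ _ (4 * (X * m')%:R ^+ 3 * (3 * m'%:R))).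
      by rewrite ler_wpM2l // mulr_ge0 ?exprn_ge0.
    have -> : 4 * (X * m')%:R ^+ 3 * (3 * m'%:R) = 12 * X%:R ^+ 3 * ((m' ^ 2)%:R * (m' ^ 2)%:R) :> R.
      by rewrite natrM natrX; ring.
    by rewrite ler_wpM2l ?mulr_ge0 ?exprn_ge0 // ler_wpM2l // ltW.
  have e2 : 32 * (N * m ^ 2 + m' ^ 2)%:R / (X * m')%:R <= 160 * m'%:R / X%:R :> R.
    rewrite ler_pdivrMr; last by rewrite ltr0n.
    have -> : 160 * m'%:R / X%:R * (X * m')%:R = 160 * m'%:R ^+ 2 :> R.
      by rewrite natrM; field; rewrite gt_eqF // (lt_le_trans _ XR).
    have : (N * m ^ 2 + m' ^ 2)%:R <= (5 * m' ^ 2)%:R :> R.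
      by rewrite ler_nat succ_sqr_le.
    by rewrite natrM natrX; lra.
  have n1 : normc (theta_sum 1 : R[i]) = 2 by rewrite theta1 normcM normc_nat normc_cis mulr1.
  have : D * m%:R <= 12 * X%:R ^+ 3 + 160 * m'%:R / X%:R + 4.
    have -> : D * m%:R = normc ((m%:R * theta_sum N - m'%:R * theta_sum 1) - (s * m%:R - m'%:R)%:C * theta_sum 1).
      rewrite /D -[X in _ * X = _](normc_nat m) -normcM; congr normc.
      by rewrite rmorphB rmorphM /= !(rmorph_nat (real_complex R)); ring.
    rewrite (le_trans (le_normcD _ _)) // normcN [normc (_ * theta_sum 1)]normcM n1 normc_real.
    rewrite ger0_norm ?subr_ge0 //.
    by move: m'gt; rewrite -natr1; lra.
  have mXE : m%:R = X%:R ^+ 4 :> R by rewrite mE natrX.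
  rewrite mXE in m'le *.
  move=> hD.
  have X3 : 1 <= X%:R ^+ 3 :> R by rewrite exprn_ege1.
  have hm : 160 * m'%:R / X%:R <= 160 * s * X%:R ^+ 3.
    rewrite ler_pdivrMr; last lra.
    have -> : 160 * s * X%:R ^+ 3 * X%:R = 160 * (s * X%:R ^+ 4) by ring.
    by move: m'le; lra.
  have : (D * X%:R) * X%:R ^+ 3 <= (16 + 160 * s) * X%:R ^+ 3.
    by move: hD; rewrite exprS; nra.
  by rewrite ler_pM2r //; lra.
have [/eq0_normc/eqP|Dn0] := eqVneq D 0; first by rewrite subr_eq0 => /eqP.
have Dp : 0 < D by rewrite lt_neqAle eq_sym Dn0.
pose y := (16 + 160 * s) / D.
have y0 : 0 <= y by rewrite divr_ge0 //; lra.
have /andP[_ hy] := truncn_itv y0.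
have /negP[] := le_gtF (key (Num.truncn y).+1 isT).
by move: hy; rewrite /y ltr_pdivrMr // [D * _]mulrC.
Qed.

End ThetaEvaluation.

(** * Reciprocity for Gauss sums *)

Section GaussReciprocity.
Context {R : realType}.
Implicit Types (a c d N X m n : nat) (b w z : int).

(** Completing the square: 2 M + b runs over one parity class modulo 4 N, and
    the other class contributes nothing because its terms change sign under
    M |-> M + N. *)
Lemma gauss1_theta b N : (0 < N)%N -> (2 %| N%:Z + b)%Z ->
  2 * cis (b%:~R ^+ 2 / (4 * N%:R)) * gauss_sum 1 b N = theta_sum N :> R[i].
Proof.
move=> N0 par; have NR : N%:R != 0 :> R by rewrite pnatr_eq0 -lt0n.
have [w e] := dvdzP par.
have /(congr1 (fun x : int => x%:~R : R)) := e.
rewrite !(intrD, intrM) -!pmulrn => eR.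
pose f z : R[i] := cis (z%:~R ^+ 2 / (4 * N%:R)).
have fper : zperiodic (4 * N) f.
  move=> z; apply: (@cis_eq _ _ _ (z + 2 * N%:Z)).
  by rewrite !(intrD, intrM, natrM, PoszM) -!pmulrn; field.
have -> : theta_sum N = \sum_(r < 2 * N * 2) f (r%:Z + b).
  have -> : (2 * N * 2 = 4 * N)%N by ring.
  rewrite (sum_residues_shift b fper); apply: eq_bigr => r _.
  by rewrite /theta_term /f -pmulrn natrM; congr cis; field.
rewrite (sum_blocks (fun r => f (r%:Z + b))) big_ord_recl big_ord1 /=.
have -> : (2 * N = N + N)%N by lia.
rewrite !big_split_ord /= /bump /=.
have even_part t : f ((0 + 2 * t)%N%:Z + b) =
    cis (b%:~R ^+ 2 / (4 * N%:R)) * gauss_term 1 b N t%:Z.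
  rewrite /f /gauss_term -cisD; congr cis.
  by rewrite add0n !(intrD, PoszM, intrM) -!pmulrn; field.
have -> : \sum_(t < N) f ((0 + 2 * t)%N%:Z + b) =
    cis (b%:~R ^+ 2 / (4 * N%:R)) * gauss_sum 1 b N.
  by rewrite mulr_sumr; apply: eq_bigr => t _; apply: even_part.
have per : zperiodic N (gauss_term (R := R) 1 b N) by apply: gauss_term_periodic; rewrite ?mul1n.
have -> : \sum_(t < N) f ((0 + 2 * (N + t))%N%:Z + b) =
    cis (b%:~R ^+ 2 / (4 * N%:R)) * gauss_sum 1 b N.
  rewrite mulr_sumr; apply: eq_bigr => t _; rewrite even_part.
  by rewrite PoszD addrC per.
have -> : \sum_(t < N) f ((1 + 0 + 2 * (N + t))%N%:Z + b) =
    - \sum_(t < N) f ((1 + 0 + 2 * t)%N%:Z + b).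
  rewrite -sumrN; apply: eq_bigr => t _.
  rewrite -mulN1r -cis1 /f -cisD; apply: (@cis_eq _ _ _ (t%:Z + w)).
  have bR : b%:~R = w%:~R * 2 - N%:R :> R by rewrite -eR; ring.
  by rewrite !(intrD, PoszM, intrM, PoszD) -!pmulrn bR; field.
by rewrite subrr addr0; ring.
Qed.

Lemma gauss1E b N : (0 < N)%N -> (2 %| N%:Z + b)%Z ->
  gauss_sum 1 b N = (Num.sqrt N%:R)%:C * cis (1 / 4 - b%:~R ^+ 2 / (4 * N%:R)) :> R[i].
Proof.
move=> N0 par; have := gauss1_theta N0 par; rewrite theta_sqrt // theta1.
set g := gauss_sum _ _ _; set u := b%:~R ^+ 2 / _ => h.
have two : 2 != 0 :> R[i] by rewrite pnatr_eq0.
apply: (mulfI (mulf_neq0 two (cis_neq0 u))); rewrite h cisD.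
transitivity (2 * (cis (- u) * cis u) * (Num.sqrt N%:R)%:C * cis (1 / 4)); last by ring.
by rewrite cisNK; ring.
Qed.

(** The product of the two sums is known by [gauss_mul] and [gauss1E]; divide
    by the second one, whose squared modulus is a. *)
Lemma gauss_recip_coprime a c b : (0 < a)%N -> (0 < c)%N -> coprime a c ->
  (2 %| (a * c)%N%:Z + b)%Z ->
  gauss_sum a b c = (Num.sqrt (c%:R / a%:R))%:C *
    cis (1 / 4 - b%:~R ^+ 2 / (4 * a%:R * c%:R)) * (gauss_sum c b a)^*%C :> R[i].
Proof.
move=> a0 c0 co par.
have ac0 : (0 < a * c)%N by rewrite muln_gt0 a0.
have aR : a%:R != 0 :> R by rewrite pnatr_eq0 -lt0n.
have aC : a%:R != 0 :> R[i] by rewrite pnatr_eq0 -lt0n.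
have par' : (2 %| (c * a)%N%:Z + b)%Z by rewrite mulnC.
have co' : coprime c a by rewrite coprime_sym.
have := gauss_mul (R := R) a0 c0 co par; rewrite gauss1E //.
move=> /(congr1 (fun x => x * (gauss_sum c b a)^*%C)).
rewrite -mulrA gauss_normr // => h.
apply: (mulIf aC); rewrite h natrM mulrA.
have -> : Num.sqrt (a%:R * c%:R) = a%:R * Num.sqrt (c%:R / a%:R) :> R.
  have -> : a%:R * c%:R = a%:R ^+ 2 * (c%:R / a%:R) :> R by field.
  by rewrite sqrtrM ?exprn_ge0 // sqrtr_sqr ger0_norm.
by rewrite rmorphM /= (rmorph_nat (real_complex R)); ring.
Qed.

(** The law of Landsberg, Schaar and Genocchi, with a linear term.  Dividing a
    and c by their greatest common divisor reduces it to coprime moduli, because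
    [gauss_gcd] treats both sides alike. *)
Theorem gauss_reciprocity a c b : (0 < a)%N -> (0 < c)%N ->
  (2 %| (a * c)%N%:Z + b)%Z ->
  gauss_sum a b c = (Num.sqrt (c%:R / a%:R))%:C *
    cis (1 / 4 - b%:~R ^+ 2 / (4 * a%:R * c%:R)) * (gauss_sum c b a)^*%C :> R[i].
Proof.
move=> a0 c0 /dvdzP[w e].
pose d := gcdn a c; have d0 : (0 < d)%N by rewrite gcdn_gt0 a0.
pose a' := (a %/ d)%N; pose c' := (c %/ d)%N.
have aE : a = (d * a')%N by rewrite mulnC divnK // dvdn_gcdl.
have cE : c = (d * c')%N by rewrite mulnC divnK // dvdn_gcdr.
have a'0 : (0 < a')%N by move: a0; rewrite {1}aE muln_gt0 d0.
have c'0 : (0 < c')%N by move: c0; rewrite {1}cE muln_gt0 d0.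
have co : coprime a' c'.
  have : (d * gcdn a' c' = d * 1)%N by rewrite muln_gcdr -aE -cE muln1.
  by move/eqP; rewrite eqn_pmul2l.
clearbody a' c' d; subst a c.
(* d and d ^ 2 have the same parity *)
have [w' e'] : exists w', (a' * c' * d)%N%:Z + b = 2 * w'.
  exists (w - a'%:Z * c'%:Z * 'C(d, 2)%:Z).
  have -> : b = w * 2 - a'%:Z * c'%:Z * (d ^ 2)%N%:Z.
    by rewrite -e !PoszM; ring.
  by rewrite sqrn_bin2 PoszD !PoszM; ring.
have e'' : (c' * a' * d)%N%:Z + b = 2 * w' by rewrite [(c' * a')%N]mulnC.
rewrite (gauss_gcd d0 c'0 e') (gauss_gcd d0 a'0 e'').
case: ifP => [dw|_]; last by rewrite rmorph0 mulr0.
have [w'' ew] := dvdzP dw.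
have db : b = (w'' * 2 - (a' * c')%N%:Z) * d%:Z.
  have -> : b = 2 * w' - (a' * c' * d)%N%:Z by rewrite -e' addrAC subrr add0r.
  by rewrite ew !PoszM; ring.
have dR : d%:R != 0 :> R by rewrite pnatr_eq0 -lt0n.
have a'R : a'%:R != 0 :> R by rewrite pnatr_eq0 -lt0n.
have c'R : c'%:R != 0 :> R by rewrite pnatr_eq0 -lt0n.
rewrite [X in _ = _ * X]rmorphM /= conjc_nat gauss_recip_coprime //; last first.
  rewrite db mulzK ?eqz_nat -?lt0n //.
  have -> : (a' * c')%N%:Z + (w'' * 2 - (a' * c')%N%:Z) = w'' * 2 by ring.
  exact: dvdz_mull.
have -> : (d * c')%:R / (d * a')%:R = c'%:R / a'%:R :> R.
  by rewrite !natrM; field; rewrite ?dR ?a'R.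
have -> : b%:~R ^+ 2 / (4 * (d * a')%:R * (d * c')%:R) =
    (b %/ d)%Z%:~R ^+ 2 / (4 * a'%:R * c'%:R) :> R.
  have bd : (d %| b)%Z by rewrite db dvdz_mull.
  rewrite -{1}(divzK bd) intrM -pmulrn !natrM; field.
  by rewrite ?a'R ?c'R ?dR.
by ring.
Qed.

End GaussReciprocity.

(** * The operators S and T *)

Section Torus.
Context {R : realType}.
Implicit Types (k c d n l : nat) (x y z : int).

Lemma cisXz (t : R) z : cis t ^ z = cis (z%:~R * t).
Proof.
case: z => n; first by rewrite -exprnP cisX.
have -> : cis t ^ Negz n = (cis t ^+ n.+1)^-1 by [].
by rewrite cisX -cisN NegzE mulrNz mulNr.
Qed.

(** The reflection z |-> 2 k - z fixes 0 and k and pairs the other residues: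
    this is how sums over colours become sums over all residues. *)
Lemma sum_fold (V : zmodType) k (h : int -> V) : (0 < k)%N ->
  h 0 = 0 -> h k%:Z = 0 -> (forall z, h ((2 * k)%N%:Z - z) = h z) ->
  \sum_(j < 2 * k) h j%:Z = (\sum_(d < k.-1) h d.+1%:Z) *+ 2.
Proof.
case: k => // k _ h0 hk hsym /=.
have -> : (2 * k.+1 = k.+1 + k.+1)%N by lia.
rewrite big_split_ord /= big_ord_recl /= h0 add0r.
rewrite [X in _ + X]big_ord_recl /= addn0 hk add0r mulr2n; congr (_ + _).
rewrite (reindex_inj rev_ord_inj) /=; apply: eq_bigr => i _.
rewrite -hsym; congr h; have := ltn_ord i; rewrite /bump /=; lia.
Qed.

Lemma kauffman_AX k n : kauffman_A R k ^+ (2 * n) = cis (n%:R / k%:R).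
Proof.
rewrite exprM /kauffman_A sqrrN -/(expi _).
have -> : expi (pi / (2 * k%:R)) = cis (1 / (2 * k%:R)) :> R[i].
  by rewrite /cis mul1r.
by rewrite !cisX; congr cis; rewrite invfM; set u := k%:R^-1; field.
Qed.

Lemma sin_pi_neq0 k : (2 <= k)%N -> sin (pi / k%:R) != 0 :> R.
Proof.
move=> k2; have kR : 0 < k%:R :> R by rewrite ltr0n; lia.
apply/lt0r_neq0/sin_gt0_pi; rewrite divr_gt0 ?pi_gt0 //=.
rewrite ltr_pdivrMr // ltr_pMr ?pi_gt0 // ltr1n; lia.
Qed.

Lemma quantum_intE k n : (2 <= k)%N ->
  quantum_int R k n = (sin (pi * (n%:R / k%:R)) / sin (pi / k%:R))%:C.
Proof.
move=> k2; rewrite /quantum_int -{3}[2%N]muln1 -{4}[2%N]muln1 !kauffman_AX -!cisN.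
rewrite !cis_sin mul1r.
have i0 : 2 * 'i%C != 0 :> R[i] by rewrite mulf_neq0 ?pnatr_eq0 // eq_complex /= oner_eq0 andbF.
by rewrite invfM mulrACA mulfV // mul1r rmorphM /= fmorphV.
Qed.

Lemma S_opE k (c d : 'I_k.-1) : S_op R k c d =
  ((-1) ^+ (c + d) * Num.sqrt (2 / k%:R) * sin (pi * ((c.+1 * d.+1)%:R / k%:R)))%:C.
Proof.
have k2 : (2 <= k)%N by have := ltn_ord c; lia.
rewrite mxE /Z_S3 /hopf quantum_intE // -(rmorphN1 (real_complex R)) -rmorphXn -!rmorphM /=.
by congr (_%:C); field; exact: sin_pi_neq0.
Qed.

Lemma twistE k c : (0 < k)%N ->
  twist R k c = cis ((c.+1%:R ^+ 2 - 1) / (2 * k%:R)).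
Proof.
move=> k0; have kR : k%:R != 0 :> R by rewrite pnatr_eq0 -lt0n.
rewrite /twist /kauffman_A.
have -> : expi (pi / (2 * k%:R)) = cis (1 / (2 * k%:R)) :> R[i].
  by rewrite /cis mul1r.
rewrite [(- cis _) ^+ _]exprNn mulrA -exprD cisX.
have -> : (c + (c ^ 2 + 2 * c) = 2 * (c + 'C(c, 2) + c))%N by rewrite sqrn_bin2; lia.
rewrite exprM sqrrN !expr1n mul1r natrD natrX natrM -natr1.
by congr cis; field.
Qed.

Lemma sin_sin_cis (a b : R) : (sin (pi * a))%:C * (sin (pi * b))%:C =
  (cis (a - b) + cis (b - a) - cis (a + b) - cis (- (a + b))) / 4 :> R[i].
Proof.
have h : 4%:R != 0 :> R[i] by rewrite pnatr_eq0.
apply: (mulIf h); rewrite divfK //.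
have -> : (cis (a - b) + cis (b - a) - cis (a + b) - cis (- (a + b))) =
  - ((cis a - cis (- a)) * (cis b - cis (- b))) :> R[i].
  by rewrite opprD !cisD; ring.
rewrite !cis_sin.
have : 'i%C * 'i%C = -1 :> R[i] by rewrite -expr2 sqr_i.
set i := ('i%C : R[i]); set u := _%:C; set v := _%:C => ii.
transitivity (- (i * i) * (4 * u * v)); last by ring.
by rewrite ii; ring.
Qed.

Lemma sin_pi_int z : sin (pi * z%:~R) = 0 :> R.
Proof.
have : cis z%:~R - cis (- z%:~R) = 0 :> R[i].
  by rewrite (@cis_eq _ (z%:~R) (- z%:~R) z) ?subrr //; ring.
rewrite cis_sin => /eqP; rewrite !mulf_eq0 pnatr_eq0 /= => /orP[].
  by rewrite eq_complex /= oner_eq0 andbF.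
by rewrite eq_complex /= eqxx andbT => /eqP.
Qed.

(** Orthogonality of the discrete sine functions. *)
Lemma S_op_involutive k : S_op R k *m S_op R k = 1%:M.
Proof.
apply/matrixP => c e; rewrite !mxE.
have k2 : (2 <= k)%N by have := ltn_ord c; lia.
have k0 : (0 < k)%N by lia.
have kR : k%:R != 0 :> R by rewrite pnatr_eq0 -lt0n.
pose h z : R[i] := (sin (pi * (c.+1%:R * z%:~R / k%:R)) * sin (pi * (e.+1%:R * z%:~R / k%:R)))%:C.
have -> : \sum_(j < k.-1) S_op R k c j * S_op R k j e =
  ((-1) ^+ (c + e) * (2 / k%:R))%:C * \sum_(d < k.-1) h d.+1%:Z.
  rewrite mulr_sumr; apply: eq_bigr => d _; rewrite !S_opE /h -!rmorphM /=; congr (_%:C).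
  have -> : (-1) ^+ (c + e) = (-1) ^+ (c + d) * (-1) ^+ (d + e) :> R.
    rewrite -exprD; have -> : (c + d + (d + e) = c + e + 2 * d)%N by lia.
    by rewrite [RHS]exprD exprM sqrrN !expr1n mulr1.
  rewrite -[2 / k%:R in RHS](@sqr_sqrtr R) ?divr_ge0 //.
  by rewrite -?pmulrn !natrM [d.+1%:R * e.+1%:R]mulrC; ring.
have hsum : \sum_(j < 2 * k) h j%:Z = if c == e then k%:R else 0.
  pose un (t : int) := \sum_(m < 2 * k) cis (2 * t%:~R * m%:R / (2 * k)%N%:R : R).
  have -> : \sum_(j < 2 * k) h j%:Z =
    (un (c.+1%:Z - e.+1%:Z) + un (e.+1%:Z - c.+1%:Z) - un (c.+1%:Z + e.+1%:Z)
     - un (- (c.+1%:Z + e.+1%:Z))) / 4.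
    rewrite /un -big_split /= -!sumrB mulr_suml; apply: eq_bigr => j _.
    rewrite /h rmorphM /= sin_sin_cis !natrM !(mulrNz, intrD) -!pmulrn.
    by congr ((cis _ + cis _ - cis _ - cis _) / 4); field.
  have k20 : (0 < 2 * k)%N by lia.
  have lc := ltn_ord c; have le := ltn_ord e.
  have small (t : int) : (`|t| < 2 * k)%N -> ((2 * k)%N %| t)%Z = (t == 0).
    move=> tk; apply/idP/eqP => [|->]; last exact: dvdz0.
    by rewrite dvdzE => /dvdn_leq; lia.
  rewrite /un !unity_sum // !small; try lia.
  have -> : (c.+1%:Z - e.+1%:Z == 0) = (c == e) by rewrite -val_eqE /=; lia.
  have -> : (e.+1%:Z - c.+1%:Z == 0) = (c == e) by rewrite -val_eqE /=; lia.
  have -> : (c.+1%:Z + e.+1%:Z == 0) = false by lia.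
  have -> : (- (c.+1%:Z + e.+1%:Z) == 0) = false by lia.
  case: eqP => _; last by rewrite !subr0 addr0 mul0r.
  by rewrite !subr0 natrM; field.
have hfold := @sum_fold _ k h k0 _ _ _.
rewrite hsum in hfold.
have two : 2%:R != 0 :> R[i] by rewrite pnatr_eq0.
apply: (mulIf two); rewrite -mulrA mulr_natr -hfold.
- have [<-|_] := eqVneq c e; last by rewrite mulr0 mul0r.
  rewrite -signr_odd addnn odd_double mul1r mulr1n mul1r rmorphM /= fmorphV !rmorph_nat.
  by rewrite divfK // pnatr_eq0 -lt0n.
- by rewrite /h mulr0 mul0r mulr0 sin0 mul0r.
- by rewrite /h -pmulrn mulfK // (sin_pi_int c.+1%:Z) mul0r.
move=> z; have s2 (a : nat) : sin (pi * (a%:R * ((2 * k)%N%:Z - z)%:~R / k%:R)) =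
   - sin (pi * (a%:R * z%:~R / k%:R)) :> R.
  have : cis (a%:R * ((2 * k)%N%:Z - z)%:~R / k%:R) = cis (- (a%:R * z%:~R / k%:R)) :> R[i].
    apply: (@cis_eq _ _ _ a%:Z).
    by rewrite intrD mulrNz -!pmulrn natrM; field.
  by rewrite /cis /expi => -[_ ->]; rewrite mulrN sinN.
by rewrite /h !s2 mulrNN.
Qed.

End Torus.

(** * The vector of a curve on the torus *)

Section Curves.
Context {R : realType}.
Implicit Types (k c d n l : nat) (x y z : int).

Definition curve_term k x y z : R[i] :=
  cis (y%:~R * z%:~R ^+ 2 / (2 * k%:R * x%:~R)) *
  (sin (pi * (z%:~R / (k%:R * x%:~R))))%:C.

(** Up to a scalar, the conjugate of the vector of the solid torus in which
    (x, y) bounds a disc.  For x = 0 this is the standard solid torus, with the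
    empty skein as vector. *)
Definition curve_vec k x y c : R[i] :=
  if x == 0 then (c == 0%N)%:R else
  ((-1) ^+ c * Num.sqrt (2 / (k * `|x|)%N%:R))%:C *
  \sum_(l < `|x|%N) curve_term k x y (c.+1 + 2 * k * l)%N%:Z.

Lemma curve_vec_opp k x y c :
  curve_vec k (- x) (- y) c = if x == 0 then curve_vec k x y c else - curve_vec k x y c.
Proof.
rewrite /curve_vec oppr_eq0; case: eqP => // _; rewrite abszN -mulrN -sumrN.
congr (_ * _); apply: eq_bigr => l _; rewrite /curve_term !mulrNz.
by rewrite !(mulrN, mulNr, invrN, opprK) sinN rmorphN mulrN.
Qed.

Lemma curve_vec_conj k x y c : (curve_vec k x y c)^*%C = curve_vec k x (- y) c.
Proof.
rewrite /curve_vec; case: eqP => _; first by rewrite conjc_nat.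
rewrite conjcM conjc_real conjc_sum; congr (_ * _).
apply: eq_bigr => l _; rewrite /curve_term conjcM conj_cis conjc_real.
by rewrite mulrNz !mulNr.
Qed.

Lemma curve_vec_twist k x y c : (0 < k)%N -> x != 0 ->
  cis (c.+1%:R ^+ 2 / (2 * k%:R)) * curve_vec k x y c = curve_vec k x (y + x) c.
Proof.
move=> k0 x0; have kR : k%:R != 0 :> R by rewrite pnatr_eq0 -lt0n.
have xR : x%:~R != 0 :> R by rewrite intr_eq0.
rewrite /curve_vec (negbTE x0) mulrCA; congr (_ * _); rewrite mulr_sumr.
apply: eq_bigr => l _; rewrite /curve_term mulrA -cisD; congr (_ * _).
apply/esym/(@cis_eq _ _ _ (c.+1%:Z * l%:Z + k%:Z * l%:Z ^+ 2)).
rewrite !(intrD, intrM, PoszM, PoszD, rmorphXn) -!pmulrn /=; field.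
by rewrite xR.
Qed.

Lemma curve_term_periodic k x y : (0 < k)%N -> x != 0 ->
  zperiodic (2 * k * `|x|) (curve_term k x y).
Proof.
move=> k0 x0 z; have kR : k%:R != 0 :> R by rewrite pnatr_eq0 -lt0n.
have xR : x%:~R != 0 :> R by rewrite intr_eq0.
pose s := sgz x.
have -> : (2 * k * `|x|)%N%:Z = 2 * k%:Z * (s * x).
  by rewrite !PoszM /s -abszEsg.
rewrite /curve_term; congr (_ * _).
  apply: (@cis_eq _ _ _ (y * s * (z + k%:Z * s * x))).
  by rewrite !(intrD, intrM) -!pmulrn; field; rewrite xR.
have : cis ((z + 2 * k%:Z * (s * x))%:~R / (k%:R * x%:~R)) =
  cis (z%:~R / (k%:R * x%:~R)) :> R[i].
  apply: (@cis_eq _ _ _ s).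
  by rewrite !(intrD, intrM) -!pmulrn; field; rewrite xR.
by rewrite /cis /expi => -[_ ->].
Qed.

Lemma curve_term_opp k x y z : curve_term k x y (- z) = - curve_term k x y z.
Proof. by rewrite /curve_term mulrNz sqrrN mulNr mulrN sinN rmorphN mulrN. Qed.

(** The sum over colours and the sum over l combine into one sum over residues
    modulo N = 2 k x.  Writing the product of two sines as a difference of
    cosines gives the Gauss sums of y and N with linear coefficients
    2 (x j -+ 1), j = c + 1, and reciprocity turns them into sums over residues
    modulo y.  There N n + x j -+ 1 = x (j + 2 k n) -+ 1, so the squares
    recombine into the vector of (- y, x).  In the phase 7 / 4, reciprocity
    contributes 1 / 4, the factor i in a difference of exponentials 1 / 2, and
    the sign of - y contributes 1. *)
Lemma S_curve_vec_pos k (x y : nat) (c : 'I_k.-1) : (0 < x)%N -> (0 < y)%N ->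
  \sum_(d < k.-1) S_op R k c d * curve_vec k x y d =
    cis (7 / 4 - (2 * k%:R * x%:R * y%:R)^-1) * curve_vec k (- y%:Z) x c.
Proof.
move=> x0 y0; have k2 : (2 <= k)%N by have := ltn_ord c; lia.
have k0 : (0 < k)%N by lia.
have kR : k%:R != 0 :> R by rewrite pnatr_eq0 -lt0n.
have xR : x%:R != 0 :> R by rewrite pnatr_eq0 -lt0n.
have yR : y%:R != 0 :> R by rewrite pnatr_eq0 -lt0n.
pose N := (2 * k * x)%N; have N0 : (0 < N)%N by rewrite !muln_gt0 k0.
pose F z : R[i] := (sin (pi * (c.+1%:R * z%:~R / k%:R)))%:C * curve_term k x y z.
pose h z : R[i] := \sum_(l < x) F (z + (2 * k * l)%N%:Z).
have Fper : zperiodic N F.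
  move=> z; rewrite /F curve_term_periodic //; last by rewrite eqz_nat -lt0n.
  congr (_%:C * _).
  have : cis (c.+1%:R * (z + N%:Z)%:~R / k%:R) = cis (c.+1%:R * z%:~R / k%:R) :> R[i].
    apply: (@cis_eq _ _ _ (c.+1%:Z * x%:Z)).
    by rewrite !(intrD, intrM, PoszM) -!pmulrn; field.
  by rewrite /cis /expi => -[_ ->].
have Fopp z : F (- z) = F z.
  by rewrite /F curve_term_opp mulrNz !(mulrN, mulNr) sinN rmorphN mulNr opprK.
have sinc z : sin (pi * (c.+1%:R * (k%:Z * z)%:~R / k%:R)) = 0 :> R.
  rewrite -(sin_pi_int (c.+1%:Z * z)); congr (sin (pi * _)).
  by rewrite !intrM -!pmulrn; field.
(* the matrix entry of S makes the summand even in the colour, so that the sum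
   over colours is half of a sum over all residues modulo 2 k x *)
have sum_h : (\sum_(d < k.-1) h d.+1%:Z) *+ 2 = \sum_(J < N) F J%:Z.
  rewrite -sum_fold //.
  - have -> : N = (x * (2 * k))%N by rewrite /N; lia.
    by rewrite (sum_blocks (fun J => F J%:Z)); apply: eq_bigr => j _.
  - rewrite /h big1 // => l _; have -> : 0 + (2 * k * l)%N%:Z = k%:Z * (2 * l%:Z).
      by rewrite !PoszM; ring.
    by rewrite /F sinc mul0r.
  - rewrite /h big1 // => l _; have -> : k%:Z + (2 * k * l)%N%:Z = k%:Z * (1 + 2 * l%:Z).
      by rewrite !PoszM; ring.
    by rewrite /F sinc mul0r.
  move=> z; rewrite /h.
  pose u (w : int) := F (z + (2 * k)%N%:Z * w).
  have uper : zperiodic x u.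
    by move=> w; rewrite /u mulrDr addrA -PoszM Fper.
  transitivity (\sum_(l < x) u (- (l%:Z + 1))).
    apply: eq_bigr => l _; rewrite -Fopp /u; congr F.
    by rewrite !PoszM; ring.
  rewrite (@sum_residues_shift _ x (fun w => u (- w)) 1); last first.
    by move=> w; rewrite opprD -(uper (- w - x%:Z)) subrK.
  rewrite (sum_residues_opp uper); apply: eq_bigr => l _.
  by rewrite /u -PoszM.
(* product-to-sum turns the result into two Gauss sums *)
pose bm := (x * c.+1)%N%:Z - 1; pose bp := (x * c.+1)%N%:Z + 1.
have par b : (2 %| (y * N)%N%:Z + 2 * b)%Z.
  have -> : (y * N)%N%:Z = 2 * (y%:Z * k%:Z * x%:Z) by rewrite /N !PoszM; ring.
  by rewrite -mulrDr dvdz_mulr.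
have sum_F : (\sum_(J < N) F J%:Z) *+ 2 = gauss_sum y (2 * bm) N - gauss_sum y (2 * bp) N.
  have two : 2%:R != 0 :> R[i] by rewrite pnatr_eq0.
  apply: (mulIf two).
  transitivity (gauss_sum y (2 * bm) N + gauss_sum y (- (2 * bm)) N
                - gauss_sum y (2 * bp) N - gauss_sum y (- (2 * bp)) N : R[i]); last first.
    by rewrite !gauss_opp //; ring.
  rewrite /gauss_sum -big_split -!sumrB /= -[X in X * _ = _]mulr_natr -mulrA mulr_suml.
  apply: eq_bigr => J _.
  have quarter (u v : R[i]) : u * (v / 4) * (2%:R * 2%:R) = u * v by field.
  rewrite /F /curve_term [(sin _)%:C * _]mulrCA sin_sin_cis quarter.
  rewrite !mulrDr !mulrN -!cisD /gauss_term.
  have Nx : N%:R = 2 * k%:R * x%:R :> R by rewrite !natrM.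
  rewrite Nx /bm /bp.
  congr (cis _ + cis _ - cis _ - cis _);
    rewrite !(intrD, intrM, mulrNz, PoszM) -!pmulrn; field; by rewrite xR.
pose A n : R := x%:R * (c.+1 + 2 * k * n)%:R ^+ 2 / (2 * k%:R * y%:R).
pose B n : R := (c.+1 + 2 * k * n)%:R / (k%:R * y%:R).
pose C : R := (2 * k%:R * x%:R * y%:R)^-1.
pose rt : R[i] := (Num.sqrt (N%:R / y%:R))%:C.
have recip (e : bool) : gauss_sum y (2 * ((x * c.+1)%N%:Z + (-1) ^+ e)) N =
    rt * cis (1 / 4 - C) * \sum_(n < y) cis (- A n - (-1) ^+ e * B n).
  rewrite gauss_reciprocity // -!mulrA; congr (_ * _).
  rewrite /gauss_sum conjc_sum !mulr_sumr; apply: eq_bigr => n _.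
  have -> : (gauss_term N (2 * ((x * c.+1)%N%:Z + (-1) ^+ e)) y n)^*%C = cis (- ((N%:R * n%:R ^+ 2 + 2 * (x%:R * c.+1%:R + (-1) ^+ e) * n%:R) / y%:R)) :> R[i].
    rewrite /gauss_term conj_cis; congr cis.
    by rewrite !(intrD, intrM, PoszM, rmorphXn, rmorphN1) -!pmulrn.
  rewrite -!cisD; congr cis.
  rewrite !(intrD, intrM, PoszM, rmorphXn, rmorphN1) -!pmulrn /=.
  have : ((-1) ^+ e) ^+ 2 = 1 :> R by rewrite sqrr_sign.
  rewrite /A /B /C !(natrD, natrM); set t := (-1) ^+ e => tt.
  have -> : (1 + 1) * (x%:R * c.+1%:R + t) *
      ((1 + 1) * (x%:R * c.+1%:R + t) / (4 * (y%:R * (2 * k%:R * x%:R)))) =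
      ((x%:R * c.+1%:R) ^+ 2 + 2 * (x%:R * c.+1%:R) * t + t ^+ 2) /
        (2 * k%:R * x%:R * y%:R) :> R.
    by field; rewrite ?kR ?xR ?yR.
  rewrite tt.
  by field; rewrite ?kR ?xR ?yR.
have -> : \sum_(d < k.-1) S_op R k c d * curve_vec k x y d =
   ((-1) ^+ c * Num.sqrt (2 / k%:R) * Num.sqrt (2 / (k * x)%N%:R))%:C *
   \sum_(d < k.-1) h d.+1%:Z.
  rewrite mulr_sumr; apply: eq_bigr => d _.
  rewrite S_opE /curve_vec eqz_nat (gtn_eqF x0) absz_nat mulrA -rmorphM /=.
  have -> : (-1) ^+ (c + d) * Num.sqrt (2 / k%:R) * sin (pi * ((c.+1 * d.+1)%:R / k%:R)) *
      ((-1) ^+ d * Num.sqrt (2 / (k * x)%:R)) =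
     (-1) ^+ c * Num.sqrt (2 / k%:R) * Num.sqrt (2 / (k * x)%:R) *
      sin (pi * ((c.+1 * d.+1)%:R / k%:R)) :> R.
    have : (-1) ^+ d * (-1) ^+ d = 1 :> R by rewrite -expr2 sqrr_sign.
    rewrite exprD; set t := (-1) ^+ d => tt.
    have -> (a b s u : R) : a * t * b * s * (t * u) = t * t * (a * b * u * s) by ring.
    by rewrite tt mul1r.
  rewrite rmorphM /= -[LHS]mulrA; congr (_ * _).
  rewrite /h mulr_sumr; apply: eq_bigr => l _; rewrite /F PoszD; congr (_ * _).
  have : cis (c.+1%:R * (d.+1%:Z + (2 * k * l)%N%:Z)%:~R / k%:R) =
     cis ((c.+1 * d.+1)%:R / k%:R) :> R[i].
    apply: (@cis_eq _ _ _ (c.+1%:Z * l%:Z)).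
    by rewrite !(intrD, intrM, PoszM, natrM) -!pmulrn; field.
  by rewrite /cis /expi => -[_ ->].
have four : 4%:R != 0 :> R[i] by rewrite pnatr_eq0.
have -> : \sum_(d < k.-1) h d.+1%:Z =
    rt * cis (1 / 4 - C) * ('i%C / 2) * \sum_(n < y) cis (- A n) * (sin (pi * B n))%:C.
  apply: (mulIf four).
  transitivity (gauss_sum y (2 * bm) N - gauss_sum y (2 * bp) N : R[i]).
    by rewrite -sum_F -sum_h -mulrnA mulr_natr.
  rewrite /bm /bp (recip true) (recip false) expr1 expr0 -mulrBr -sumrB.
  rewrite -!mulrA; congr (_ * (_ * _)); rewrite !mulr_suml !mulr_sumr.
  apply: eq_bigr => n _; rewrite mulN1r mul1r opprK !cisD -mulrBr cis_sin.
  by field.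
have s8 : Num.sqrt (2 / k%:R) * Num.sqrt (2 / (k * x)%N%:R) * Num.sqrt (N%:R / y%:R) =
   2 * Num.sqrt (2 / (k * y)%N%:R) :> R.
  rewrite -!sqrtrM ?mulr_ge0 ?invr_ge0 //.
  have -> : 2 / k%:R * (2 / (k * x)%:R) * (N%:R / y%:R) = 2 ^+ 2 * (2 / (k * y)%:R) :> R.
    by rewrite !natrM; field; rewrite ?kR ?xR ?yR.
  by rewrite sqrtrM ?exprn_ge0 // sqrtr_sqr ger0_norm.
rewrite /curve_vec oppr_eq0 eqz_nat (gtn_eqF y0) abszN absz_nat.
have -> : \sum_(l < y) curve_term k (- y%:Z) x (c.+1 + 2 * k * l)%N%:Z =
    - \sum_(n < y) cis (- A n) * (sin (pi * B n))%:C.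
  rewrite -sumrN; apply: eq_bigr => n _; rewrite /curve_term /A /B !mulrNz -!pmulrn.
  by rewrite !mulrN !invrN !mulrN sinN rmorphN mulrN.
set T := \sum_(n < y) _.
have -> : cis (7 / 4 - C) = - ('i%C * cis (1 / 4 - C)) :> R[i].
  have -> : 7 / 4 - C = 1 + (1 / 2 + (1 / 4 - C)) :> R by field.
  by rewrite -cis_half -cisD [LHS]cisD cis1 mulN1r.
move: s8; rewrite /rt; set sa := Num.sqrt _; set sb := Num.sqrt _.
set sc := Num.sqrt _; set sd := Num.sqrt _ => s8.
have s8C : sa%:C * sb%:C * sc%:C = 2 * sd%:C :> R[i].
  by rewrite -!rmorphM s8 rmorphM /= rmorph_nat.
have -> : ((-1) ^+ c * sa * sb)%:C = ((-1) ^+ c)%:C * (sa%:C * sb%:C) :> R[i].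
  by rewrite -!rmorphM mulrA.
rewrite rmorphM /=; set e := ((-1) ^+ c)%:C.
transitivity (e * (sa%:C * sb%:C * sc%:C) * (cis (1 / 4 - C) * ('i%C / 2) * T) : R[i]).
  by ring.
by rewrite s8C; field.
Qed.

End Curves.

(** * Equality up to the anomaly *)

Section Phases.
Context {R : realType}.
Implicit Types (k n : nat) (x y r : int) (s : R).

Definition level_family := forall k, 'I_k.-1 -> R[i].
Implicit Types f g h : level_family.

(** Equality up to the indeterminacy that the expansion can absorb: an eighth
    root of unity independent of k, and a phase analytic in 1 / k. *)
Definition phased f g := exists r s, forall k, (2 <= k)%N -> forall c : 'I_k.-1,
  f k c = cis (r%:~R / 4 + s / k%:R) * g k c.

Definition S_action f : level_family := fun k c => \sum_(d < k.-1) S_op R k c d * f k d.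

Definition curve_family x y : level_family := fun k c => curve_vec k x y c.

Definition conjf f : level_family := fun k c => (f k c)^*%C.

Lemma phased_eq f g : (forall k, (2 <= k)%N -> forall c : 'I_k.-1, f k c = g k c) ->
  phased f g.
Proof.
by move=> e; exists 0, 0 => k k2 c; rewrite mul0r add0r mul0r cis0 mul1r e.
Qed.

Lemma phased_opp f g : (forall k, (2 <= k)%N -> forall c : 'I_k.-1, f k c = - g k c) ->
  phased f g.
Proof.
move=> e; exists 4%:Z, 0 => k k2 c; rewrite mul0r addr0 e //.
have -> : 4%:Z%:~R / 4 = 1 :> R by field.
by rewrite cis1 mulN1r.
Qed.

Lemma phased_trans f g h : phased f g -> phased g h -> phased f h.
Proof.
move=> [r [s e]] [r' [s' e']]; exists (r + r'), (s + s') => k k2 c.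
by rewrite e // e' // mulrA -cisD intrD; congr (cis _ * _); ring.
Qed.

Lemma phased_sym f g : phased f g -> phased g f.
Proof.
move=> [r [s e]]; exists (- r), (- s) => k k2 c.
by rewrite e // mulrA -cisD mulrNz !mulNr -opprD addNr cis0 mul1r.
Qed.

Lemma phased_conj f g : phased f g -> phased (conjf f) (conjf g).
Proof.
move=> [r [s e]]; exists (- r), (- s) => k k2 c.
by rewrite /conjf e // conjcM conj_cis mulrNz !mulNr opprD.
Qed.

Lemma phased_S_action f g : phased f g -> phased (S_action f) (S_action g).
Proof.
move=> [r [s e]]; exists r, s => k k2 c; rewrite /S_action mulr_sumr.
by apply: eq_bigr => d _; rewrite e // mulrCA.
Qed.

Lemma S_actionK f k (c : 'I_k.-1) : S_action (S_action f) c = f k c.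
Proof.
transitivity ((S_op R k *m (S_op R k *m \col_d f k d)) c 0).
  rewrite [RHS]mxE; apply: eq_bigr => d _; congr (_ * _); rewrite [RHS]mxE.
  by apply: eq_bigr => e _; congr (_ * _); rewrite mxE.
by rewrite mulmxA S_op_involutive mul1mx mxE.
Qed.

Lemma conj_S_op k (c d : 'I_k.-1) : (S_op R k c d)^*%C = S_op R k c d.
Proof. by rewrite S_opE conjc_real. Qed.

Lemma conjf_S_action f k (c : 'I_k.-1) : S_action (conjf f) c = conjf (S_action f) c.
Proof.
by rewrite /conjf /S_action conjc_sum; apply: eq_bigr => d _; rewrite conjcM conj_S_op.
Qed.

Lemma curve_family_opp x y : phased (curve_family (- x) (- y)) (curve_family x y).
Proof.
have [x0|x0] := eqVneq x 0.
  by apply: phased_eq => k _ c; rewrite /curve_family curve_vec_opp x0 eqxx.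
by apply: phased_opp => k _ c; rewrite /curve_family curve_vec_opp (negbTE x0).
Qed.

Lemma S_action_family_opp x y : phased (S_action (curve_family x y)) (curve_family (- y) x) ->
  phased (S_action (curve_family (- x) (- y))) (curve_family (- - y) (- x)).
Proof.
move=> P; apply: phased_trans (phased_S_action (curve_family_opp x y)) _.
exact: phased_trans P (phased_sym (curve_family_opp _ _)).
Qed.

Lemma S_action_family_conj x y : phased (S_action (curve_family x y)) (curve_family (- y) x) ->
  phased (S_action (curve_family x (- y))) (curve_family (- - y) x).
Proof.
move=> P; apply: (@phased_trans _ (conjf (S_action (curve_family x y)))).
  apply: phased_eq => k _ c; rewrite -conjf_S_action.
  by apply: eq_bigr => d _; rewrite /conjf /curve_family curve_vec_conj.
apply: phased_trans (phased_conj P) _.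
apply: (@phased_trans _ (curve_family (- y) (- x))).
  by apply: phased_eq => k _ c; rewrite /conjf /curve_family curve_vec_conj.
by apply: phased_trans (phased_sym (curve_family_opp _ _)) _; rewrite !opprK; apply: phased_eq.
Qed.

Lemma S_action_family01 k (c : 'I_k.-1) : S_action (curve_family 0 1) c = curve_family 1 0 c.
Proof.
have k2 : (2 <= k)%N by have := ltn_ord c; lia.
have k0 : (0 < k.-1)%N by lia.
rewrite /S_action (bigD1 (Ordinal k0)) //= big1 => [|d]; last first.
  by rewrite -val_eqE /= => /negbTE d0; rewrite /curve_family /curve_vec eqxx d0 mulr0.
rewrite /curve_family {1}/curve_vec eqxx mulr1 addr0 S_opE /curve_vec /= muln1 big_ord1 /curve_term.
rewrite mul0r mul0r cis0 mul1r -rmorphM /= addn0 muln1 muln0 addn0; congr (_%:C).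
by rewrite mulr1 -pmulrn.
Qed.

(** The signs of x and y are changed by passing to (- x, - y) and by complex
    conjugation, which commutes with S; when x or y is 0 the other one is a unit
    and S exchanges the two vectors, being an involution. *)
Lemma S_action_family x y u v : x * u - y * v = 1 ->
  phased (S_action (curve_family x y)) (curve_family (- y) x).
Proof.
move=> det1.
have pos (a b : nat) : (0 < a)%N -> (0 < b)%N -> phased (S_action (curve_family a b)) (curve_family (- b%:Z) a).
  move=> a0 b0; exists 7%:Z, (- (2 * a%:R * b%:R)^-1) => k k2 c.
  rewrite /S_action S_curve_vec_pos //; congr (cis _ * _).
  by field; rewrite !pnatr_eq0 -!lt0n a0 b0 /=; lia.
have y0case z : z = 1 \/ z = - 1 -> phased (S_action (curve_family z 0)) (curve_family (- 0) z).
  have h1 : phased (S_action (curve_family 1 0)) (curve_family (- 0) 1).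
    apply: phased_eq => k _ c; rewrite oppr0 -[RHS](S_actionK (curve_family 0 1) c).
    by apply: eq_bigr => d _; rewrite S_action_family01.
  by case=> ->; [|have := S_action_family_opp h1; rewrite !oppr0].
have x0case z : z = 1 \/ z = - 1 -> phased (S_action (curve_family 0 z)) (curve_family (- z) 0).
  have h1 : phased (S_action (curve_family 0 1)) (curve_family (- 1) 0).
    apply: phased_trans (phased_eq (fun k _ => @S_action_family01 k)) _.
    by have := phased_sym (curve_family_opp 1 0); rewrite oppr0.
  by case=> ->; [|have := S_action_family_opp h1; rewrite !oppr0].
have unit_pm (a b : int) : a * b = 1 -> a = 1 \/ a = -1.
  by move/(congr1 absz)/eqP; rewrite abszM muln_eq1 => /andP[/eqP ? _]; lia.
have [y0|y0] := eqVneq y 0.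
  by subst y; apply: y0case; apply: (@unit_pm x u); lia.
have [x0|x0] := eqVneq x 0.
  by subst x; apply: x0case; apply: (@unit_pm y (- v)); lia.
have posx (a : nat) z : (0 < a)%N -> z != 0 -> phased (S_action (curve_family a z)) (curve_family (- z) a).
  move=> a0; case: z => [b|b] b0; first by apply: pos => //; lia.
  by rewrite NegzE; apply: S_action_family_conj; apply: pos.
case: x x0 {det1} => [a|a] x0; first by apply: posx => //; lia.
rewrite NegzE; have := @posx a.+1 (- y) isT; rewrite oppr_eq0 => /(_ y0).
by move/S_action_family_opp; rewrite opprK.
Qed.

Lemma twist_family x y : phased (fun k c => twist R k c * curve_family x y c) (curve_family x (x + y)).
Proof.
have [->|x0] := eqVneq x 0.
  apply: phased_eq => k k2 c; rewrite /curve_family /curve_vec eqxx.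
  case: eqP => [->|_]; last by rewrite !mulr0.
  by rewrite twistE ?expr1n ?subrr ?mul0r ?cis0 ?mulr1 //; lia.
exists 0, (- (1 / 2)) => k k2 c; rewrite /curve_family [x + y]addrC -curve_vec_twist //; last by lia.
rewrite mulrA -cisD twistE; last by lia.
congr (cis _ * _); have kR : k%:R != 0 :> R by rewrite pnatr_eq0; lia.
by field.
Qed.

Lemma twist_conj k n : (0 < k)%N -> (twist R k n)^*%C = (twist R k n)^-1.
Proof. by move=> k0; rewrite twistE // conj_cis cisN. Qed.

Lemma twist_neq0 k n : (0 < k)%N -> twist R k n != 0.
Proof. by move=> k0; rewrite twistE // cis_neq0. Qed.

Lemma untwist_family x y : phased (fun k c => (twist R k c)^-1 * curve_family x y c) (curve_family x (y - x)).
Proof.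
have [r [s e]] := phased_sym (twist_family x (y - x)).
exists r, s => k k2 c; have := e k k2 c; rewrite addrC subrK => ->.
by rewrite mulrCA mulKf // twist_neq0 //; lia.
Qed.

End Phases.

(** * Words in the mapping class group *)

Section Tracking.
Context {R : realType}.
Implicit Types (phi psi chi : 'M[int]_2).
Implicit Types (v w : forall k : nat, torus_space R k).
Implicit Types (U : forall k : nat, 'M[R[i]]_k.-1).

(** The matrix of T uses inverse twists, hence the conjugate of v.  The
    vector is that of the second column of psi, the image of the meridian, and
    the determinant records that this column is primitive. *)
Definition tracks psi v := \det psi = 1 /\
  phased (fun k c => (v k c 0)^*%C) (curve_family (psi 0 1) (psi 1 1)).

(** The last clause is the statement about inverses, phrased without inverse
    matrices so that it passes through products. *)
Definition implements phi U := [/\ \det phi = 1,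
  forall k, (2 <= k)%N -> U k \in unitmx,
  forall psi v, tracks psi v -> tracks (phi *m psi) (fun k => U k *m v k) &
  forall psi chi v w, tracks psi v -> phi *m chi = psi ->
    (forall k, (2 <= k)%N -> U k *m w k = v k) -> tracks chi w].

Lemma lift01 : lift ord0 ord0 = 1 :> 'I_2.
Proof. exact: val_inj. Qed.

Lemma mulmx2E (A B : 'M[int]_2) i j :
  (A *m B) i j = A i 0 * B 0 j + A i 1 * B 1 j.
Proof. by rewrite mxE big_ord_recl big_ord1 lift01. Qed.

Lemma det_mx2E (A : 'M[int]_2) : \det A = A 0 0 * A 1 1 - A 0 1 * A 1 0.
Proof.
rewrite (expand_det_row _ 0) big_ord_recl big_ord1 lift01 /cofactor !det_mx11 !mxE.
have -> : lift (0 : 'I_2) 0 = 1 by exact: val_inj.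
have -> : lift (1 : 'I_2) 0 = 0 by exact: val_inj.
by rewrite /= expr0 expr1 mulN1r mulrN mul1r.
Qed.

Lemma S_mat_mul psi : (S_mat *m psi) 0 1 = - psi 1 1 /\ (S_mat *m psi) 1 1 = psi 0 1.
Proof. by rewrite !mulmx2E !mxE /=; split; ring. Qed.

Lemma T_mat_mul psi :
  (T_mat *m psi) 0 1 = psi 0 1 /\ (T_mat *m psi) 1 1 = psi 0 1 + psi 1 1.
Proof. by rewrite !mulmx2E !mxE /=; split; ring. Qed.

Lemma det_S_mat : \det S_mat = 1.
Proof. by rewrite det_mx2E !mxE. Qed.

Lemma det_T_mat : \det T_mat = 1.
Proof. by rewrite det_mx2E !mxE. Qed.

(** Primitivity of the second column of psi, which [S_action_family] needs when
    one of its entries is 0, is read off the determinant. *)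
Lemma tracks_S_action psi v : tracks psi v ->
  phased (fun k c => ((S_op R k *m v k) c 0)^*%C) (curve_family (- psi 1 1) (psi 0 1)).
Proof.
move=> [dpsi tr].
apply: (@phased_trans _ _ (S_action (fun k c => (v k c 0)^*%C))).
  apply: phased_eq => k _ c; rewrite [RHS](@conjf_S_action _ (fun k c => v k c 0)).
  by rewrite /conjf /S_action [X in X^*%C]mxE.
apply: phased_trans (phased_S_action tr) _.
apply: (@S_action_family _ _ _ (- psi 1 0) (- psi 0 0)).
by rewrite -dpsi det_mx2E; ring.
Qed.

Lemma implements_S : implements S_mat (S_op R).
Proof.
split; first exact: det_S_mat.
- by move=> k k2; case: (mulmx1_unit (S_op_involutive (R := R) k)).
- move=> psi v trv; split; first by rewrite det_mulmx det_S_mat trv.1.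
  have [-> ->] := S_mat_mul psi; exact: tracks_S_action.
move=> psi chi v w trv e vw; have [e0 e1] := S_mat_mul chi; rewrite e in e0 e1.
split; first by move: trv.1; rewrite -e det_mulmx det_S_mat mul1r.
apply: (@phased_trans _ _ (fun k c => ((S_op R k *m v k) c 0)^*%C)).
  by apply: phased_eq => k k2 c; rewrite -vw // mulmxA S_op_involutive mul1mx.
apply: phased_trans (tracks_S_action trv) _; rewrite e0 e1.
exact: curve_family_opp.
Qed.

Lemma T_opE k (u : torus_space R k) (c : 'I_k.-1) :
  (T_op R k *m u) c 0 = (twist R k c)^-1 * u c 0.
Proof. by rewrite mul_diag_mx !mxE. Qed.

Lemma T_op_unit k : (2 <= k)%N -> T_op R k \in unitmx.
Proof.
move=> k2; rewrite unitmxE det_diag unitfE; apply/prodf_neq0 => c _.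
by rewrite mxE invr_neq0 // twist_neq0; lia.
Qed.

Lemma implements_T : implements T_mat (T_op R).
Proof.
split; [exact: det_T_mat|exact: T_op_unit| |].
- move=> psi v [dpsi tr]; split; first by rewrite det_mulmx det_T_mat dpsi.
  have [-> ->] := T_mat_mul psi; apply: phased_trans (twist_family _ _).
  have [r [s h]] := tr; exists r, s => k k2 c.
  rewrite T_opE conjcM h // conjc_inv twist_conj ?invrK; last by lia.
  by rewrite mulrCA.
move=> psi chi v w [dpsi tr] e vw.
have [e0 e1] := T_mat_mul chi; rewrite e in e0 e1.
split; first by move: dpsi; rewrite -e det_mulmx det_T_mat mul1r.
have -> : chi 1 1 = psi 1 1 - psi 0 1 by rewrite e0 e1 addrC addKr.
rewrite -e0; apply: phased_trans (untwist_family _ _).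
have [r [s h]] := tr; exists r, s => k k2 c.
have k0 : (0 < k)%N by lia.
have := h k k2 c; rewrite -vw // T_opE conjcM conjc_inv twist_conj // invrK => h'.
by rewrite mulrCA -h' mulKf // twist_neq0.
Qed.

(** The property is closed under products and inverses, so only the two
    generators need to be examined. *)
Lemma implements_mcg phi U : mcg_action phi U -> implements phi U.
Proof.
elim=> {phi U}.
- exact: implements_S.
- exact: implements_T.
- split; first exact: det1.
  + by move=> k _; apply: unitmx1.
  + move=> psi v [d tr]; split; rewrite mul1mx //.
    by apply: phased_trans tr; apply: phased_eq => k _ c; rewrite mul1mx.
  move=> psi chi v w [d tr]; rewrite mul1mx => -> h; split => //.
  by apply: phased_trans tr; apply: phased_eq => k k2 c; rewrite -h // mul1mx.
- move=> phi U _ [dphi unitU fwd bwd]; have phiu : phi \in unitmx by rewrite unitmxE dphi unitr1.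
  split; first by rewrite det_inv dphi invr1.
  + by move=> k k2; rewrite unitmx_inv unitU.
  + move=> psi v tr; apply: bwd tr _ _; first by rewrite mulmxA mulmxV // mul1mx.
    by move=> k k2; rewrite mulmxA mulmxV ?unitU // mul1mx.
  move=> psi chi v w tr e vw.
  have [d h] := fwd _ _ tr; rewrite -e mulmxA mulmxV // mul1mx in d h.
  split=> //; apply: phased_trans h; apply: phased_eq => k k2 c.
  by rewrite -vw // mulmxA mulmxV ?unitU // mul1mx.
move=> phi psi U V _ [dphi unitU fwdU bwdU] _ [dpsi unitV fwdV bwdV]; split.
- by rewrite det_mulmx dphi dpsi.
- by move=> k k2; rewrite unitmx_mul unitU // unitV.
- move=> chi v /fwdV /fwdU [d h]; split; rewrite -mulmxA //.
  by apply: phased_trans h; apply: phased_eq => k _ c; rewrite mulmxA.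
move=> chi om v w tr; rewrite -mulmxA => e vw.
apply: (bwdV _ _ _ _ (bwdU _ _ _ (fun k => V k *m w k) tr e _) erefl) => // k k2.
by rewrite mulmxA vw.
Qed.

Lemma tracks_solid_torus : tracks 1%:M (Z_solid_torus R).
Proof.
split; first exact: det1.
by apply: phased_eq => k _ c; rewrite !mxE /curve_family /curve_vec eqxx conjc_nat.
Qed.

(** The Hermitian product with the empty skein reads off the coordinate of
    index 0. *)
Lemma Z_lensE (p q : nat) (Z : nat -> R[i]) : is_Z_lens p q Z ->
  exists r (s : R), forall k, (2 <= k)%N ->
    Z k = cis (r%:~R / 4 + s / k%:R) * curve_vec k p q 0.
Proof.
move=> [phi [U [n [[dphi [e [e0 e1]]] act ZE]]]].
have [_ _ fwd _] := implements_mcg act.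
have [_ tr] := fwd _ _ tracks_solid_torus; rewrite mulmx1 e0 e1 in tr.
have {tr} : phased (fun k c => ((U k *m Z_solid_torus R k) c 0)^*%C) (curve_family p q).
  apply: phased_trans tr _; case: e {e0 e1} => /=.
    by rewrite expr1 !mulN1r; apply: curve_family_opp.
  by rewrite expr0 !mul1r; apply: phased_eq.
move=> [r [s h]].
(* tau_k is cis (3 / 4 - (3 / 2) / k) *)
exists (r + 3 * n), (s - n%:~R * (3 / 2)) => k k2.
have k0 : (0 < k.-1)%N by lia.
have kR : k%:R != 0 :> R by rewrite pnatr_eq0; lia.
rewrite ZE // /hermitian (bigD1 (Ordinal k0)) //= big1 => [|d]; last first.
  by rewrite -val_eqE /= => /negbTE d0; rewrite mxE d0 mul0r.
rewrite mxE eqxx mul1r addr0 h // mulrA /curve_family /=; congr (_ * _).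
have -> : tau R k = cis (3 / 4 - 3 / (2 * k%:R)).
  by rewrite /tau /cis; congr expi; field.
by rewrite cisXz -cisD; congr cis; rewrite !(intrD, intrM); field.
Qed.

End Tracking.

(** * Asymptotic expansion *)

Section Expansion.
Context {R : realType}.
Implicit Types (k n : nat) (s h : R).

Lemma powRNhalf (x : R) : 0 < x -> x `^ (- (1 / 2)) = (Num.sqrt x)^-1.
Proof. by move=> x0; rewrite powRN mul1r powR12_sqrt // ltW. Qed.

Lemma powR3half (x : R) : 0 < x -> x `^ (3 / 2) = x * Num.sqrt x.
Proof.
move=> x0; have -> : 3 / 2 = 1 + 2^-1 :> R by field.
rewrite powRD; last by rewrite (gt_eqF x0) implybT.
by rewrite powRr1 ?powR12_sqrt // ltW.
Qed.

Context (p q : nat) (p0 : (0 < p)%N).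

Let pR : p%:R != 0 :> R.
Proof. by rewrite pnatr_eq0 -lt0n. Qed.

(** These are the coefficients b in the factors cis (b / k) of a summand. *)
Definition freqm s : R := s + q%:R / (2 * p%:R) - p%:R^-1.
Definition freqp s : R := s + q%:R / (2 * p%:R) + p%:R^-1.
(** The cosines come from averaging the summands of l and - l. *)
Definition ampm (l : nat) : R := cos (pi * (2 * l%:R / p%:R - 2 * q%:R * l%:R / p%:R)).
Definition ampp (l : nat) : R := cos (pi * (2 * l%:R / p%:R + 2 * q%:R * l%:R / p%:R)).
(** As a function of h = 1 / k, the coefficient of the l-th phase after
    averaging. *)
Definition amplitude s l h : R[i] := (Num.sqrt (2 / p%:R) / 2)%:C *
  ((ampm l)%:C * cis (freqm s * h) - (ampp l)%:C * cis (freqp s * h)).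

(** The summands of l and - l carry the same phase in q l^2; expanding the
    sines into exponentials and regrouping by frequency gives the cosines. *)
Lemma curve_term_pair k (l : nat) : (0 < k)%N ->
  curve_term k p q (1 + (2 * k)%N%:Z * l%:Z) + curve_term k p q (1 + (2 * k)%N%:Z * - l%:Z) =
  'i%C * cis (2 * (q%:R * l%:R ^+ 2 / p%:R) * k%:R) *
  ((ampm l)%:C * cis (freqm 0 * k%:R^-1) - (ampp l)%:C * cis (freqp 0 * k%:R^-1)) :> R[i].
Proof.
move=> k0; have kR : k%:R != 0 :> R by rewrite pnatr_eq0 -lt0n.
have i2 : 2 * 'i%C != 0 :> R[i].
  by rewrite mulf_neq0 ?pnatr_eq0 // eq_complex /= oner_eq0 andbF.
apply: (mulfI i2); rewrite /curve_term mulrDr ![2 * 'i%C * (cis _ * _)]mulrCA -!cis_sin.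
set D := cis (2 * _ * _).
have -> : 2 * 'i%C * ('i%C * D * ((ampm l)%:C * cis (freqm 0 / k%:R) - (ampp l)%:C * cis (freqp 0 / k%:R)))
  = D * ((2 * (ampp l)%:C) * cis (freqp 0 / k%:R) - (2 * (ampm l)%:C) * cis (freqm 0 / k%:R)) :> R[i].
  have : 'i%C * 'i%C = -1 :> R[i] by rewrite -expr2 sqr_i.
  set i := ('i%C : R[i]); set a := (ampm l)%:C; set b := (ampp l)%:C => ii.
  set cm := cis _; set cp := cis _.
  transitivity (i * i * (2 * D * (a * cm - b * cp))); first by ring.
  by rewrite ii; ring.
have regroup (a t a' t' d u w e f : R) :
    a + t = d + u + e -> a - t = d - w + f ->
    a' + t' = d - u + e -> a' - t' = d + w + f ->
    cis a * (cis t - cis (- t)) + cis a' * (cis t' - cis (- t')) =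
    cis d * ((cis u + cis (- u)) * cis e - (cis w + cis (- w)) * cis f) :> R[i].
  by move=> e1 e2 e3 e4; rewrite !mulrBr -!cisD e1 e2 e3 e4 !cisD; ring.
rewrite /ampp /ampm -!cis_cos /D.
by apply: regroup; rewrite /freqm /freqp !(intrD, intrM, mulrNz) -!pmulrn ?natrM;
  field; rewrite kR.
Qed.

(** The summands depend on l modulo p only, so the sum equals half the sum of
    the terms of l and - l together. *)
Lemma curve_vec_lens k : (0 < k)%N ->
  curve_vec k p q 0 = ((Num.sqrt k%:R)^-1)%:C * cis (1 / 2) *
    \sum_(l < p) cis (2 * (q%:R * l%:R ^+ 2 / p%:R) * k%:R) * amplitude 0 l k%:R^-1.
Proof.
move=> k0; have kR : k%:R != 0 :> R by rewrite pnatr_eq0 -lt0n.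
rewrite /curve_vec eqz_nat (gtn_eqF p0) absz_nat expr0 mul1r.
pose g z : R[i] := curve_term k p q (1 + (2 * k)%N%:Z * z).
have gper : zperiodic p g.
  move=> z; rewrite /g mulrDr addrA -PoszM curve_term_periodic //.
  by rewrite eqz_nat -lt0n.
have -> : \sum_(l < p) curve_term k p q (1 + 2 * k * l)%N%:Z = \sum_(l < p) g l%:Z.
  by apply: eq_bigr => l _; rewrite /g PoszD (PoszM (2 * k)).
have two : 2%:R != 0 :> R[i] by rewrite pnatr_eq0.
apply: (mulIf two).
have -> : (Num.sqrt (2 / (k * p)%N%:R))%:C * (\sum_(l < p) g l%:Z) * 2%:R =
   (Num.sqrt (2 / (k * p)%N%:R))%:C * \sum_(l < p) (g l%:Z + g (- l%:Z)).
  by rewrite big_split /= (sum_residues_opp gper) -mulrA mulr_natr mulr2n.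
rewrite -!mulrA; set S := \sum_(l < p) _ * _.
have -> : Num.sqrt (2 / (k * p)%N%:R) = (Num.sqrt k%:R)^-1 * Num.sqrt (2 / p%:R) :> R.
  rewrite -sqrtrV // -sqrtrM ?invr_ge0 //; congr Num.sqrt.
  by rewrite natrM; field; rewrite kR pR.
rewrite rmorphM /= -mulrA; congr (_ * _); rewrite /S mulr_suml !mulr_sumr.
apply: eq_bigr => l _; rewrite /g curve_term_pair // cis_half /amplitude.
rewrite (rmorphM (real_complex R)) /= fmorphV rmorph_nat.
by field.
Qed.

Lemma amplitude_shift s l h : cis (s * h) * amplitude 0 l h = amplitude s l h.
Proof.
rewrite /amplitude mulrCA mulrBr ![cis (s * h) * (_ * _)]mulrCA -!cisD.
by congr (_ * (_ * cis _ - _ * cis _)); rewrite /freqm /freqp; ring.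
Qed.

Definition acoef s (l n : nat) : R[i] := (Num.sqrt (2 / p%:R) / 2)%:C *
  (expi_coef n * (pi ^+ n * (ampm l * freqm s ^+ n - ampp l * freqp s ^+ n))%:C).

Lemma cis_expansion (b : R) N h :
  normc (cis (b * h) - \sum_(n < N) expi_coef n * (((pi * b) ^+ n)%:C * h%:C ^+ n))
    <= 2 * `|pi * b| ^+ N * `|h| ^+ N.
Proof.
rewrite /cis mulrA; have := taylor_expi_bound N (pi * b * h).
rewrite normrM exprMn mulrA; congr (normc (_ - _) <= _).
by apply: eq_bigr => n _; rewrite rmorphM /= exprMn -rmorphXn.
Qed.

Lemma amplitude_expansion s l N : exists2 C : R, 0 <= C &
  forall h, normc (amplitude s l h - \sum_(n < N) acoef s l n * h%:C ^+ n)
    <= C * `|h| ^+ N.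
Proof.
pose bound f : R := 2 * `|pi * f| ^+ N.
have b0 f : 0 <= bound f by rewrite mulr_ge0 ?exprn_ge0.
pose w := Num.sqrt (2 / p%:R) / 2 : R.
exists (`|w| * (`|ampm l| * bound (freqm s) + `|ampp l| * bound (freqp s))).
  by rewrite mulr_ge0 ?addr_ge0 ?mulr_ge0.
move=> h; pose rem f := cis (f * h) - \sum_(n < N) expi_coef n * (((pi * f) ^+ n)%:C * h%:C ^+ n).
have -> : amplitude s l h - \sum_(n < N) acoef s l n * h%:C ^+ n =
   w%:C * ((ampm l)%:C * rem (freqm s) - (ampp l)%:C * rem (freqp s)).
  pose T f := \sum_(n < N) expi_coef n * (((pi * f) ^+ n)%:C * h%:C ^+ n).
  have -> : \sum_(n < N) acoef s l n * h%:C ^+ n =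
      w%:C * ((ampm l)%:C * T (freqm s) - (ampp l)%:C * T (freqp s)).
    rewrite /T !mulr_sumr -sumrB mulr_sumr; apply: eq_bigr => n _.
    rewrite /acoef !exprMn !(rmorphM (real_complex R)) rmorphB /= !rmorphM /=.
    by rewrite -/w; ring.
  by rewrite /rem -/(T _) -/(T _) /amplitude -/w; ring.
rewrite normcM normc_real -mulrA; apply: ler_wpM2l => //.
rewrite (le_trans (le_normcD _ _)) // normcN !normcM !normc_real mulrDl -!mulrA.
by apply: lerD; apply: ler_wpM2l => //; by rewrite mulrA; apply: cis_expansion.
Qed.

End Expansion.

Section Coefficients.
Context {R : realType} (p q : nat) (s : R).
Context (co : coprime p q) (p0 : (0 < p)%N).

(** For degenerate l the constant term vanishes and the series is divided by
    1 / k, in accordance with [m_exp]. *)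
Definition lens_coef (l : 'I_p) (n : nat) : R[i] :=
  acoef p q s l (if degenerate l then n.+1 else n).

Let pR : p%:R != 0 :> R. Proof. by rewrite pnatr_eq0 -lt0n. Qed.

Lemma cos_pi_even (z : int) : cos (pi * (2 * z%:~R)) = 1 :> R.
Proof. by have := @cis_even_int R z; rewrite /cis /expi => -[]. Qed.

(** For l = p / 2 the number p is even, so q is odd and the angles are even
    multiples of pi. *)
Lemma amp_degenerate (l : 'I_p) : degenerate l ->
  ampm p q l = 1 :> R /\ ampp p q l = 1 :> R.
Proof.
rewrite /ampm /ampp => /orP[/eqP -> | /eqP lp].
  by rewrite mulr0 mul0r mulr0 mul0r subr0 addr0 mulr0 cos0.
have oddq : odd q.
  rewrite -[odd q]negbK -dvdn2; apply/negP => q2.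
  have : (2 %| gcdn p q)%N by rewrite dvdn_gcd q2 -lp dvdn_mulr.
  by rewrite (eqP co).
have lR : 2 * l%:R = p%:R :> R by rewrite -natrM lp.
have -> : 2 * q%:R * l%:R / p%:R = q%:R :> R.
  have -> : 2 * q%:R * l%:R = q%:R * p%:R :> R by rewrite -lR; ring.
  by rewrite mulfK.
rewrite lR divff //.
have qE : q%:R = 1 + 2 * (q./2%:Z)%:~R :> R.
  by rewrite -{1}(odd_double_half q) oddq natrD -muln2 natrM mulrC.
split; [rewrite -[RHS](cos_pi_even (- q./2%:Z))|rewrite -[RHS](cos_pi_even (1 + q./2%:Z))];
  congr (cos (pi * _)); rewrite qE ?intrD ?mulrNz; ring.
Qed.

Lemma lens_coef0 (l : 'I_p) : lens_coef l 0%N = a_lead R q l.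
Proof.
rewrite /lens_coef /a_lead; case: ifP => [deg|_].
  have [em ep] := amp_degenerate deg.
  have -> : acoef p q s l 1 = (Num.sqrt (2 / p%:R) / 2)%:C * ('i%C *
      (pi * (freqm p q s - freqp p q s))%:C).
    by rewrite /acoef em ep !expr1 !mul1r /expi_coef cis_half divr1.
  rewrite /freqm /freqp.
  have -> : pi * (s + q%:R / (2 * p%:R) - p%:R^-1 - (s + q%:R / (2 * p%:R) + p%:R^-1))
     = - (2 * pi / p%:R) :> R by ring.
  rewrite powR3half ?ltr0n // sqrtrM // sqrtrV //.
  rewrite [LHS]mulrCA -rmorphM mulNr -mulrN -rmorphN; congr (_ * _%:C).
  have sp : Num.sqrt p%:R != 0 :> R by rewrite gt_eqF // sqrtr_gt0 ltr0n.
  by field; rewrite pR sp.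
rewrite /acoef !expr0 mulr1 mul1r !mulr1 /expi_coef mul0r cis0 fact0 divr1 mul1r -rmorphM.
congr (_%:C); rewrite /ampm /ampp [pi * (_ - _)]mulrBr [pi * (_ + _)]mulrDr cosB cosD.
have -> : 2 * pi * q%:R * l%:R / p%:R = pi * (2 * q%:R * l%:R / p%:R) :> R by ring.
have -> : 2 * pi * l%:R / p%:R = pi * (2 * l%:R / p%:R) :> R by ring.
by field.
Qed.

Lemma acoef0_degenerate (l : 'I_p) : degenerate l -> acoef p q s l 0 = 0.
Proof.
move=> deg; have [em ep] := amp_degenerate deg.
by rewrite /acoef em ep !expr0 subrr !mulr0.
Qed.

(** In the degenerate case the vanishing constant term allows a factor 1 / k to
    be taken out, at the price of one more term of the series. *)
Lemma degenerate_shift (l : 'I_p) N k : (0 < k)%N ->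
  (k%:R `^ m_exp R l)%:C * \sum_(n < N.+1) lens_coef l n * k%:R ^- n =
  ((Num.sqrt k%:R)^-1)%:C *
    \sum_(n < N.+1 + degenerate l) acoef p q s l n * ((k%:R^-1)%:C : R[i]) ^+ n.
Proof.
move=> k0; have kC n : ((k%:R^-1)%:C : R[i]) ^+ n = k%:R ^- n.
  by rewrite fmorphV rmorph_nat exprVn.
have kR : 0 < k%:R :> R by rewrite ltr0n.
rewrite /m_exp /lens_coef; case: ifP => deg; last first.
  rewrite addn0 powRNhalf //; congr (_ * _).
  by apply: eq_bigr => n _; rewrite kC.
rewrite addn1 [in RHS]big_ord_recl /= (acoef0_degenerate deg) mul0r add0r.
rewrite powRN powR3half // invfM mulrC [k%:R^-1 * _]mulrC.
rewrite rmorphM /= mulrCA; congr (_ * _); rewrite mulrC mulr_sumr.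
by apply: eq_bigr => n _; rewrite -kC exprS mulrCA.
Qed.

End Coefficients.

Theorem theorem6p2 (R : realType) (p q : nat) (Z : nat -> R[i]) :
  coprime p q -> (1 < q < p)%N -> is_Z_lens p q Z ->
  exists (m : int) (a : 'I_p -> nat -> R[i]),
    (forall l : 'I_p, a l 0%N = a_lead R q l) /\
    forall N : nat,
      (fun k : nat => Z k - lens_expansion q m a N k : R[i]^o)
        =O_\oo (fun k : nat => k%:R ^- N.+1 : R[i]^o).
Proof.
move=> co /andP[q1 qp] /Z_lensE[r [s ZE]].
have p0 : (0 < p)%N by lia.
(* the factor i = cis (1 / 2) of [curve_vec_lens] joins the root of unity *)
exists (r + 2), (lens_coef q s); split => [l|N]; first exact: lens_coef0.
have /choice[C CP] : forall l : 'I_p, exists C : R, 0 <= C /\ forall h,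
    normc (amplitude p q s l h -
      \sum_(n < N.+1 + degenerate l) acoef p q s l n * h%:C ^+ n)
    <= C * `|h| ^+ (N.+1 + degenerate l).
  by move=> l; have [C C0 CP] := @amplitude_expansion R p q s l (N.+1 + degenerate l); exists C.
pose K := \sum_(l < p) C l.
have K0 : 0 <= K by apply: sumr_ge0 => l _; have [] := CP l.
have bound k : (2 <= k)%N ->
    normc (Z k - lens_expansion q (r + 2) (@lens_coef R p q s) N k) <= K * k%:R ^- N.+1.
  move=> k2; have k0 : (0 < k)%N by lia.
  have kR : 0 < k%:R :> R by rewrite ltr0n.
  pose E (l : 'I_p) : R[i] := cis (2 * (q%:R * l%:R ^+ 2 / p%:R) * k%:R).
  have -> : Z k = cis ((r + 2)%:~R / 4) * \sum_(l < p)
      ((Num.sqrt k%:R)^-1)%:C * E l * amplitude p q s l k%:R^-1.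
    rewrite ZE // curve_vec_lens //.
    have -> : cis (r%:~R / 4 + s / k%:R) = cis (r%:~R / 4) * cis (s * k%:R^-1) :> R[i].
      by rewrite cisD.
    have -> : cis ((r + 2)%:~R / 4) = cis (r%:~R / 4) * cis (1 / 2) :> R[i].
      by rewrite -cisD; congr cis; rewrite intrD; field.
    rewrite !mulr_sumr; apply: eq_bigr => l _.
    by rewrite -(amplitude_shift _ _ s) /E; ring.
  have -> : lens_expansion q (r + 2) (@lens_coef R p q s) N k =
     cis ((r + 2)%:~R / 4) * \sum_(l < p) ((Num.sqrt k%:R)^-1)%:C * E l *
      \sum_(n < N.+1 + degenerate l) acoef p q s l n * ((k%:R^-1)%:C : R[i]) ^+ n.
    rewrite /lens_expansion; congr (_ * _).
      by rewrite /cis; congr expi; ring.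
    apply: eq_bigr => l _; rewrite mulrAC degenerate_shift // mulrAC; congr (_ * _ * _).
    by rewrite /E /cis; congr expi; ring.
  rewrite -mulrBr -sumrB normcM normc_cis mul1r (le_trans (normc_sum _ _ _)) //.
  rewrite /K mulr_suml; apply: ler_sum => l _.
  have [C0 Cb] := CP l.
  rewrite -mulrBr normcM normcM normc_cis mulr1 normc_real.
  have k1 : k%:R^-1 <= 1 :> R by rewrite invf_le1 // ler1n.
  have s1 : `|(Num.sqrt k%:R)^-1| <= 1 :> R.
    rewrite ger0_norm ?invr_ge0 ?sqrtr_ge0 // invf_le1 ?sqrtr_gt0 //.
    by rewrite -[leLHS]sqrtr1 ler_sqrt // ler1n.
  have Cb' : normc (amplitude p q s l k%:R^-1 - \sum_(n < N.+1 + degenerate l)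
       acoef p q s l n * (k%:R^-1)%:C ^+ n) <= C l * k%:R ^- N.+1.
    rewrite (le_trans (Cb _)) //; apply: ler_wpM2l => //.
    rewrite ger0_norm ?invr_ge0 // -exprVn exprD ler_piMr ?exprn_ge0 ?invr_ge0 //.
    by rewrite exprn_ile1 ?invr_ge0.
  apply: le_trans Cb'; rewrite ler_piMl //; exact: normc_ge0.
apply/eqO_exP; exists (K + 1)%:C; first by rewrite ltcR ltr_wpDl.
exists 2%N => // k /= k2.
have -> : `|(k%:R ^- N.+1 : R[i]^o)| = (k%:R ^- N.+1)%:C.
  rewrite normrV ?unitfE ?expf_neq0 ?pnatr_eq0 //; last by lia.
  by rewrite normrX normr_nat fmorphV rmorphXn rmorph_nat.
rewrite -rmorphM normcE lecR (le_trans (bound _ k2)) // ler_wpM2r //.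
by rewrite lerDl.
Qed.
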